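(* Let $G=(V,E,\nu,\mu)$ be a weighted graph such that $M:=\sup_{x\in V}\frac{\deg_x}{\nu_x}<\infty$, and let $p\in(1,2]$. Then there is a constant $C_p>0$ (independent of $f$ and $t$) such that for every $f\in\mathcal{C}_0(V)$ and every $t>0$, $$\||Df|\|^2_{\ell^p(E,\mu)}\le C_p\,\|f\|_{\ell^p(V,\nu)}\,\|\Delta f\|_{\ell^p(V,\nu)}$$ and $$\||De^{-t\Delta}f|\|_{\ell^p(E,\mu)}\le C_p\,t^{-1/2}\,\|f\|_{\ell^p(V,\nu)}.$$
   Context: A weighted graph $G=(V,E,\nu,\mu)$ consists of a connected, locally finite, undirected graph $(V,E)$ (each vertex has finitely many neighbors; $x\sim y$ means $\{x,y\}\in E$), vertex weights $\nu:V\to(0,\infty)$, $x\mapsto\nu_x$, and symmetric edge weights $\mu:E\to(0,\infty)$, $\{x,y\}\mapsto\mu_{xy}=\mu_{yx}$, extended to $V\times V$ by $\mu_{xy}=0$ if $\{x,y\}\notin E$. Put $\deg_x:=\sum_{y\in V}\mu_{xy}$. $\mathcal{C}_0(V)$ denotes the finitely supported real functions on $V$. The spaces $\ell^p(V,\nu)$ and $\ell^p(E,\mu)$ are the usual $\ell^p$ spaces over the discrete measure spaces $(V,\nu)$ and $(E,\mu)$. The Laplacian is $\Delta f(x)=\frac1{\nu_x}\sum_{y}\mu_{xy}(f(x)-f(y))$; when $\sup_x\deg_x/\nu_x<\infty$ it is a bounded nonnegative self-adjoint operator on $\ell^2(V,\nu)$, and it generates the semigroup $e^{-t\Delta}$ acting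 on $\ell^p(V,\nu)$, $p\in[1,\infty]$. For $f:V\to\mathbb{R}$, $|Df|:E\to\mathbb{R}$ is defined by $|Df|(\{x,y\})=|f(x)-f(y)|$, so $\||Df|\|_{\ell^p(E,\mu)}^p=\sum_{\{x,y\}\in E}\mu_{xy}|f(x)-f(y)|^p$. *)

(* Defs.v *)
From HB Require Import structures.
From Stdlib Require Import Relation_Operators.
From mathcomp Require Import all_boot all_order all_algebra.
From mathcomp Require Import all_classical all_reals all_analysis finmap.
Set Implicit Arguments.
Unset Strict Implicit.
Unset Printing Implicit Defensive.
Import Order.TTheory GRing.Theory Num.Theory.
Import numFieldNormedType.Exports.
Local Open Scope classical_set_scope.
Local Open Scope ring_scope.

(* An edge is an unordered pair, i.e. a set [set x; y].  The functions [ew]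
   (edge weights) and [absD] below live on all of [set V], but only their
   values on [edges] matter.  Loops [set x; x] are not excluded. *)
Record weighted_graph (R : realType) (V : choiceType) := WeightedGraph {
  edges : set (set V) ;
  nu : V -> R ;
  ew : set V -> R ;
  edgesP : forall e, edges e -> exists x y, e = [set x; y] ;
  locally_finite : forall x, finite_set [set y | edges [set x; y]] ;
  graph_connected : forall x y,
    clos_refl_trans V (fun u v => edges [set u; v]) x y ;
  nu_gt0 : forall x, 0 < nu x ;
  ew_gt0 : forall e, edges e -> 0 < ew e
}.

Section WeightedGraphDefs.
Context {R : realType} {V : choiceType}.
Implicit Types (G : weighted_graph R V) (f : V -> R).

Definition mu G (x y : V) : R :=
  if [set x; y] \in edges G then ew G [set x; y] else 0.

Lemma muC G x y : mu G x y = mu G y x.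
Proof. by rewrite /mu setUC. Qed.

(* The sums over V below have finite support by [locally_finite]. *)
Definition deg G (x : V) : R := \sum_(y \in [set: V]) mu G x y.

Definition laplacian G f (x : V) : R :=
  (nu G x)^-1 * \sum_(y \in [set: V]) mu G x y * (f x - f y).

Definition finitely_supported f := finite_set [set x | f x != 0].

(* Norm of l^p over the discrete measure space D with weight w on points. *)
Definition lp_norm (T : choiceType) (D : set T) (w : T -> R) (p : R)
    (g : T -> R) : \bar R :=
  ((\esum_(i in D) (w i * `|g i| `^ p)%:E) `^ p^-1)%E.

(* Oscillation of f on the edge; see [absDE]. *)
Definition absD f (e : set V) : R :=
  sup [set `|f z.1 - f z.2| | z in e `*` e].

Lemma absDE f x y : absD f [set x; y] = `|f x - f y|.
Proof.
rewrite /absD; set S := (X in sup X).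
have Sxy : S `|f x - f y| by exists (x, y) => //=; split; [left|right].
have ubS : ubound S `|f x - f y|.
  move=> _ [[u v] /= [[->|->] [->|->]] <-]; rewrite ?subrr ?normr0 //.
  by rewrite distrC.
apply/le_anti/andP; split; first by apply: ge_sup => //; exists `|f x - f y|.
by apply: ub_le_sup => //; exists `|f x - f y|.
Qed.

(* The operator exponential exp(-t Delta), as the exponential series of the
   bounded operator -t Delta.  Convergence in l^2(V, nu) implies pointwise
   convergence to the same limit, hence evaluation at x inside the limit; see
   [heat_cvg] for the convergence. *)
Definition heat G (t : R) f (x : V) : R :=
  limn (series (fun k : nat => (- t) ^+ k / k`!%:R * iter k (laplacian G) f x)).

Lemma laplacian_bound G M B f : (forall x, deg G x / nu G x <= M) ->
  (forall x, `|f x| <= B) -> forall x, `|laplacian G f x| <= 2 * M * B.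
Proof.
move=> hM hB x; rewrite /laplacian.
have B0 : 0 <= B by rewrite (le_trans (normr_ge0 _) (hB x)).
have fin := locally_finite G x.
have sub : forall h : V -> R, \sum_(y \in [set: V]) mu G x y * h y =
   \sum_(y <- fset_set [set y | edges G [set x; y]]) mu G x y * h y.
  move=> h; rewrite -(fsbig_widen [set y | edges G [set x; y]]) ?fsbig_finite //.
  by move=> y [_ /= ny]; rewrite /mu memNset ?mul0r.
have mu0 y : 0 <= mu G x y.
  by rewrite /mu; case: ifPn => // /set_mem /ew_gt0 /ltW.
rewrite (sub (fun y => f x - f y)).
have degE : deg G x = \sum_(y <- fset_set [set y | edges G [set x; y]]) mu G x y.
  rewrite /deg -(fsbig_widen [set y | edges G [set x; y]]) ?fsbig_finite //.
  by move=> y [_ /= ny]; rewrite /mu memNset.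
have n0 := nu_gt0 G x.
rewrite normrM gtr0_norm ?invr_gt0//.
apply: (@le_trans _ _ ((nu G x)^-1 * (deg G x * (2 * B)))); last first.
  rewrite mulrA [_^-1 * _]mulrC [2 * M]mulrC -[M * 2 * B]mulrA ler_wpM2r ?mulr_ge0//.
rewrite ler_wpM2l ?invr_ge0 ?(ltW n0)// degE mulr_suml.
apply: (le_trans (ler_norm_sum _ _ _)); apply: ler_sum => y _.
rewrite normrM (ger0_norm (mu0 y)) ler_wpM2l// mulr2n mulrDl mul1r.
by apply: (le_trans (ler_normB _ _)); exact: lerD.
Qed.

Lemma heat_cvg G M t f : (forall x, deg G x / nu G x <= M) -> finitely_supported f ->
  forall x, cvgn (series (fun k : nat => (- t) ^+ k / k`!%:R * iter k (laplacian G) f x)).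
Proof.
move=> hM ff x.
have [B hB] : exists B, forall y, `|f y| <= B.
  exists (\sum_(y <- fset_set [set y | f y != 0]) `|f y|) => y.
  have [->|fy] := eqVneq (f y) 0; first by rewrite normr0 sumr_ge0.
  rewrite (bigD1_seq y) ?fset_uniq//= ?lerDl ?sumr_ge0//.
  by rewrite in_fset_set//; exact: mem_set.
have M2 k : forall y, `|iter k (laplacian G) f y| <= (2 * M) ^+ k * B.
  elim: k => [|k IH] y /=; first by rewrite expr0 mul1r.
  by rewrite exprS -mulrA; exact: laplacian_bound.
have B0 : 0 <= B := le_trans (normr_ge0 _) (hB x).
apply: normed_cvg.
have h : cvgn (series (B *: exp_coeff (`|t| * (2 * M)))).
  by apply: is_cvg_seriesZ; exact: is_cvg_series_exp_coeff.
have n0 := nu_gt0 G x.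
have degp : 0 <= deg G x / nu G x.
  apply: divr_ge0 (ltW n0); rewrite /deg; apply: fsumr_ge0 => y _.
  by rewrite /mu; case: ifPn => // /set_mem /ew_gt0 /ltW.
have M0 : 0 <= M := le_trans degp (hM x).
apply: series_le_cvg h => k //=.
  by rewrite mulr_ge0// divr_ge0// exprn_ge0// !mulr_ge0.
rewrite normrM normf_div normrX normrN (ger0_norm (ler0n _ _)).
apply: le_trans (_ : `|t| ^+ k / k`!%:R * ((2 * M) ^+ k * B) <= _).
  by rewrite ler_wpM2l ?M2// divr_ge0// exprn_ge0.
rewrite -[leRHS]/(B * ((`|t| * (2 * M)) ^+ k / k`!%:R)) (exprMn k `|t|).
by rewrite mulrA [leRHS]mulrC [X in _ <= X * _]mulrAC.
Qed.

End WeightedGraphDefs.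

(* Main.v *)
Require Import Defs.
From HB Require Import structures.
From mathcomp Require Import all_boot all_order all_algebra.
From mathcomp Require Import all_classical all_reals all_analysis.
From mathcomp Require Import finmap ring lra.
Set Implicit Arguments.
Unset Strict Implicit.
Unset Printing Implicit Defensive.
Import Order.TTheory GRing.Theory Num.Theory.
Import numFieldNormedType.Exports.
Local Open Scope classical_set_scope.
Local Open Scope ring_scope.

(** Why the two inequalities hold.  Write phi(a) = |a|^(p-2) a and let u, v be
    the p-th powers of the l^p norms of f and Delta f.

    The gradient estimate.  By Green's formula the pairing of Delta f with
    phi(f) is half the sum over pairs x, y of
    mu_xy (f x - f y) (phi (f x) - phi (f y)), and for 1 < p <= 2 each term is at
    least (p - 1) mu_xy |f x - f y|^2 max(|f x|, |f y|)^(p-2)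
    ([monotone_form_real_ge]).  Hoelder bounds the pairing by
    v^(1/p) u^(1-1/p) ([energy_le_lp_mass]).  The singular weight max^(p-2) is
    then traded against the sum of mu_xy max^p, which is at most 2 M u, by a
    second use of Hoelder with exponents 2/p and 2/(2-p).  The outcome is
    || |Df| ||_p^p <= c (u v)^(1/2) ([gradient_estimate]), which is the first
    inequality.

    The heat semigroup.  Applying this estimate to e^(-t Delta) f requires the
    contraction bound on l^p and the analyticity bound
    ||Delta e^(-t Delta) f||_p <= (c / t) ||f||_p.  Both are proved for the Euler
    iterates (1 - (t/N) Delta)^(N-1) f, which stay finitely supported, so only
    finite sums occur, and both constants are uniform in N.

    For complex valued f the number <Delta f, phi f> lies in the sector
    |Im| <= Re / (p - 1) ([skew_form_le]).  Hence for z in the dual sector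
    |Im z| <= (p - 1) Re z the first order term of ||f - z Delta f||_p^p is
    nonpositive and one Euler step multiplies this quantity by at most
    1 + K |z|^p ([sector_step]).  As p > 1, N steps of size t/N cost a factor
    tending to 1.

    The disc of centre t and radius (p - 1) t / p lies in the sector, and Cauchy's
    estimate for the polynomial z -> (1 - (z/N) Delta)^N f on that disc bounds its
    derivative - Delta (1 - (t/N) Delta)^(N-1) f at t: this is analyticity
    ([lp_mass_laplacian_euler]).  Since a polynomial is involved, Cauchy's formula
    is an exact average over roots of unity ([rotation_average]).

    Finally the Euler iterates converge pointwise to e^(-t Delta) f
    ([euler_cvg_heat]), and the bound passes to the limit on every finite set of
    edges by a Fatou argument ([finite_sum_powR_fatou]).

    Complex numbers are represented by their real and imaginary parts. *)

(** * Convexity inequalities for real powers *)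

Lemma weighted_amgm (R : realType) (th x y : R) : 0 <= th <= 1 ->
  0 <= x -> 0 <= y -> x `^ th * y `^ (1 - th) <= th * x + (1 - th) * y.
Proof.
move=> /andP[th0 th1] x0 y0.
have [->|thN0] := eqVneq th 0.
  by rewrite powRr0 subr0 powRr1// !mul1r mul0r add0r.
have [->|thN1] := eqVneq th 1.
  by rewrite subrr powRr0 powRr1// !mul1r mul0r addr0 mulr1.
have th_gt0 : 0 < th by rewrite lt_neqAle eq_sym thN0.
have th_lt1 : 0 < 1 - th by rewrite subr_gt0 lt_neqAle thN1.
have := @conjugate_powR R (x `^ th) (y `^ (1 - th)) th^-1 (1 - th)^-1
  (powR_ge0 _ _) (powR_ge0 _ _).
rewrite -!powRrM !mulfV ?gt_eqF// !powRr1// !invrK !invr_gt0 [th + _]addrC subrK.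
by move=> /(_ th_gt0 th_lt1 erefl); rewrite (mulrC x) (mulrC y).
Qed.

(** Hoelder's inequality: once the two sums on the right are normalised to 1 it is
    the sum of the weighted arithmetic-geometric inequalities.  If one of them
    vanishes then so does every term on the left. *)
Lemma hoelder_sum (R : realType) (I : Type) (r : seq I) (w a b : I -> R) (th : R) :
  0 <= th <= 1 ->
  (forall i, 0 <= w i) -> (forall i, 0 <= a i) -> (forall i, 0 <= b i) ->
  \sum_(i <- r) w i * (a i `^ th * b i `^ (1 - th)) <=
  (\sum_(i <- r) w i * a i) `^ th * (\sum_(i <- r) w i * b i) `^ (1 - th).
Proof.
move=> th01 w0 a0 b0; have /andP[th0 th1] := th01.
have zero (s : seq I) (c d : I -> R) (e : R) : e != 0 -> (forall i, 0 <= c i) ->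
    \sum_(i <- s) w i * c i = 0 -> \sum_(i <- s) w i * (c i `^ e * d i) = 0.
  move=> e0 c0; elim: s => [|i s IH]; first by rewrite !big_nil.
  rewrite !big_cons => /eqP; rewrite paddr_eq0 ?mulr_ge0//; last first.
    by apply: sumr_ge0 => j _; rewrite mulr_ge0.
  case/andP=> wc /eqP/IH ->; rewrite addr0.
  by move: wc; rewrite mulf_eq0 => /orP[/eqP ->|/eqP ->];
    rewrite ?mul0r// powR0// mul0r mulr0.
set A := \sum_(i <- r) w i * a i; set B := \sum_(i <- r) w i * b i.
have A0 : 0 <= A by apply: sumr_ge0 => i _; rewrite mulr_ge0.
have B0 : 0 <= B by apply: sumr_ge0 => i _; rewrite mulr_ge0.
have [->|thN0] := eqVneq th 0.
  rewrite subr0 powRr0 mul1r powRr1// le_eqVlt; apply/orP; left; apply/eqP.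
  by apply: eq_bigr => i _; rewrite powRr0 mul1r powRr1.
have [->|thN1] := eqVneq th 1.
  rewrite subrr powRr0 mulr1 powRr1// le_eqVlt; apply/orP; left; apply/eqP.
  by apply: eq_bigr => i _; rewrite powRr0 mulr1 powRr1.
have th1N : 1 - th != 0 by rewrite subr_eq0 eq_sym.
have [A_eq0|A_neq0] := eqVneq A 0; first by rewrite zero// mulr_ge0 ?powR_ge0.
have [B_eq0|B_neq0] := eqVneq B 0.
  under eq_bigr do rewrite [_ `^ th * _]mulrC.
  by rewrite zero// mulr_ge0 ?powR_ge0.
have A_gt0 : 0 < A by rewrite lt_neqAle eq_sym A_neq0.
have B_gt0 : 0 < B by rewrite lt_neqAle eq_sym B_neq0.
have AB_gt0 : 0 < A `^ th * B `^ (1 - th) by rewrite mulr_gt0 ?powR_gt0.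
rewrite -(ler_pM2r (_ : 0 < (A `^ th * B `^ (1 - th))^-1)) ?invr_gt0//.
rewrite mulfV ?gt_eqF// mulr_suml.
apply: (@le_trans _ _ (\sum_(i <- r) (th * (w i * a i) / A + (1 - th) * (w i * b i) / B))).
  apply: ler_sum => i _.
  have := weighted_amgm th01 (divr_ge0 (a0 i) A0) (divr_ge0 (b0 i) B0).
  rewrite !powRM ?invr_ge0// -[A^-1]powR_inv1// -[B^-1]powR_inv1//.
  rewrite ![_ `^ (-1) `^ _]powRAC ![_ `^ (-1)]powR_inv1 ?powR_ge0// => h.
  have := ler_wpM2l (w0 i) h; rewrite invfM => {}h.
  apply: le_trans (le_trans h _); rewrite le_eqVlt; apply/orP; left; apply/eqP; ring.
rewrite big_split/= -!mulr_suml -!mulr_sumr -/A -/B -!mulrA !mulfV// !mulr1.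
by rewrite addrC subrK.
Qed.

(** The graph of s -> s^p lies above its tangent at c.  It is multiplied out in
    a form that needs no case distinction at c = 0. *)
Lemma powR_tangent (R : realType) (p s c : R) : 1 <= p -> 0 <= s -> 0 <= c ->
  p * (c `^ (p - 1) * s) <= (p - 1) * c `^ p + s `^ p.
Proof.
move=> p1 s0 c0; have p0 : 0 < p by lra.
have th01 : 0 <= p^-1 <= 1 by rewrite invr_ge0 invf_le1// ltW.
have := weighted_amgm th01 (powR_ge0 s p) (powR_ge0 c p).
rewrite -!powRrM mulfV ?gt_eqF// powRr1//.
have -> : p * (1 - p^-1) = p - 1 by rewrite mulrBr mulr1 mulfV ?gt_eqF.
move=> h; have := ler_wpM2l (ltW p0) h; clear h.
rewrite mulrDr !mulrA mulfV ?gt_eqF// mul1r mulrBr mulr1 mulfV ?gt_eqF//.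
by rewrite mulrAC [s `^ p + _]addrC.
Qed.

Lemma powR_add_le (R : realType) (p a b : R) : 0 <= p <= 2 -> 0 <= a -> 0 <= b ->
  (a + b) `^ p <= 4 * (a `^ p + b `^ p).
Proof.
move=> /andP[p0 p2] a0 b0.
wlog ab : a b a0 b0 / a <= b.
  move=> h; case: (leP a b) => [|/ltW] ab; first exact: h.
  by rewrite addrC [X in _ * X]addrC h.
apply: (@le_trans _ _ ((2 * b) `^ p)); first by rewrite ge0_ler_powR ?nnegrE; lra.
rewrite powRM//; apply: ler_pM; rewrite ?powR_ge0 ?lerDr ?powR_ge0//.
have -> : 4 = 2 `^ 2 :> R by rewrite powR_mulrn//; lra.
by apply: ler_powR => //; lra.
Qed.

(** * The map a -> |a|^(p-2) a on the plane *)

Section Plane.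
Variables (R : realType) (p : R).
Hypotheses (p_gt1 : 1 < p) (p_le2 : p <= 2).

Local Ltac lra_p := move: (p_gt1) (p_le2) => ? ?; lra.

Definition modulus (a1 a2 : R) : R := Num.sqrt (a1 ^+ 2 + a2 ^+ 2).

Lemma modulus_ge0 a1 a2 : 0 <= modulus a1 a2.
Proof. exact: sqrtr_ge0. Qed.

Lemma modulus_sqr a1 a2 : modulus a1 a2 ^+ 2 = a1 ^+ 2 + a2 ^+ 2.
Proof. by rewrite sqr_sqrtr// addr_ge0 ?sqr_ge0. Qed.

Lemma modulus_eq0 a1 a2 : modulus a1 a2 = 0 -> a1 = 0 /\ a2 = 0.
Proof.
move=> h; have /eqP := modulus_sqr a1 a2.
rewrite h expr0n/= eq_sym paddr_eq0 ?sqr_ge0// !sqrf_eq0.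
by case/andP=> /eqP -> /eqP ->.
Qed.

Lemma modulus_real a : modulus a 0 = `|a|.
Proof. by rewrite /modulus expr0n addr0 sqrtr_sqr. Qed.

Lemma modulus_le x y z : 0 <= z -> x ^+ 2 + y ^+ 2 <= z ^+ 2 -> modulus x y <= z.
Proof. by move=> z0 h; rewrite -(ler_sqr (modulus_ge0 x y)) ?modulus_sqr. Qed.

Lemma dot_le_modulus a1 a2 b1 b2 :
  a1 * b1 + a2 * b2 <= modulus a1 a2 * modulus b1 b2.
Proof.
have P0 : 0 <= modulus a1 a2 * modulus b1 b2 by rewrite mulr_ge0 ?modulus_ge0.
apply: le_trans (ler_norm _) _.
rewrite -(ler_sqr (normr_ge0 _)) ?nnegrE// real_normK ?num_real//.
rewrite exprMn !modulus_sqr -subr_ge0.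
by rewrite (_ : _ - _ = (a1 * b2 - a2 * b1) ^+ 2) ?sqr_ge0//; ring.
Qed.

(** The value at the origin is a default, which is harmless because the weight
    only multiplies quantities that vanish there. *)
Definition phi_weight (a1 a2 : R) : R := modulus a1 a2 `^ (p - 2).

(** With a, b in C and phi a = |a|^(p-2) a, the forms [monotone_form] and
    [skew_form] are the real and imaginary parts of
    conj (a - b) (phi a - phi b). *)
Definition monotone_form (a1 a2 b1 b2 : R) : R :=
  (a1 - b1) * (phi_weight a1 a2 * a1 - phi_weight b1 b2 * b1) +
  (a2 - b2) * (phi_weight a1 a2 * a2 - phi_weight b1 b2 * b2).

Definition skew_form (a1 a2 b1 b2 : R) : R :=
  (a1 - b1) * (phi_weight a1 a2 * a2 - phi_weight b1 b2 * b2) -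
  (a2 - b2) * (phi_weight a1 a2 * a1 - phi_weight b1 b2 * b1).

Lemma power_weight_mul (A : R) : 0 <= A -> A `^ (p - 2) * A = A `^ (p - 1).
Proof.
move=> A0; rewrite mulrC (_ : p - 2 = (p - 1) - 1); last by ring.
by rewrite mulr_powRB1//; lra_p.
Qed.

Lemma power_weight_sqr (A : R) : 0 <= A -> A `^ (p - 2) * A ^+ 2 = A `^ p.
Proof.
by move=> A0; rewrite expr2 mulrA power_weight_mul// mulrC mulr_powRB1//; lra_p.
Qed.

Lemma power_weight_antimono (A B : R) : 0 < B <= A -> A `^ (p - 2) <= B `^ (p - 2).
Proof.
move=> /andP[B0 BA]; have A0 : 0 < A by exact: lt_le_trans BA.
rewrite -opprB !powRN lef_pV2 ?posrE ?powR_gt0//.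
by rewrite ge0_ler_powR ?nnegrE ?(ltW A0) ?(ltW B0)//; lra_p.
Qed.

(** Concavity of s -> s^(p-1): the chord dominates the slope at the larger end
    point. *)
Lemma power_increment (A B : R) : 0 < B <= A ->
  (p - 1) * A `^ (p - 2) * (A - B) <= A `^ (p - 2) * A - B `^ (p - 2) * B.
Proof.
move=> /andP[B0 BA]; have A0 : 0 < A by exact: lt_le_trans BA.
have th01 : 0 <= p - 1 <= 1 by apply/andP; split; lra_p.
have := weighted_amgm th01 (ltW B0) (ltW A0).
move/(ler_wpM2l (powR_ge0 A (p - 2))).
rewrite mulrCA -powRD; last by rewrite (gt_eqF A0) implybT.
rewrite (_ : p - 2 + (1 - (p - 1)) = 0); last by ring.
rewrite powRr0 mulr1 -power_weight_mul; last exact: ltW.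
by move=> h; lra_p.
Qed.

(** The scalar content of the two bounds on the plane.  Here A, B are the moduli
    of a, b, the weights are al = A^(p-2) and be = B^(p-2), q = A B - <a, b> is
    the defect in Cauchy-Schwarz and w = a1 b2 - a2 b1, so that the hypothesis
    on w is Lagrange's identity.  In these terms the monotone form splits into
    a radial part (al A - be B) (A - B) and an angular part (al + be) q.  The
    skew form is (al - be) w; its square is at most twice the product of the
    angular part and (be - al)^2 A B / (al + be), and the latter is at most
    1 / (p - 1) times the radial part. *)
Lemma monotone_form_lower_bounds (al be A B q w : R) :
  0 <= al <= be -> 0 <= B <= A -> be * B <= al * A ->
  (p - 1) * al * (A - B) <= al * A - be * B -> 0 <= q ->
  w ^+ 2 = q * (2 * A * B - q) ->
  (p - 1) * ((be - al) * `|w|) <=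
    (al * A - be * B) * (A - B) + (al + be) * q /\
  (p - 1) * (al * ((A - B) ^+ 2 + 2 * q)) <=
    (al * A - be * B) * (A - B) + (al + be) * q.
Proof.
move=> /andP[al0 ab] /andP[B0 BA] bBaA inc q0 wE.
have AB0 : 0 <= A - B by rewrite subr_ge0.
have radial : (p - 1) * (al * (A - B) ^+ 2) <= (al * A - be * B) * (A - B).
  by have := ler_wpM2r AB0 inc; lra_p.
have p1 : 0 <= p - 1 <= 1 by apply/andP; split; lra_p.
have P0 : 0 <= (al + be) * q by rewrite mulr_ge0// addr_ge0// (le_trans al0).
have Q0 : 0 <= al * (A - B) ^+ 2 by rewrite mulr_ge0 ?sqr_ge0.
have scale (u v : R) : 0 <= u -> u <= v -> (p - 1) * u <= v.
  move=> u0 uv; apply: le_trans uv; rewrite -[leRHS]mul1r ler_wpM2r//; lra_p.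
split.
  suff h : (be - al) * `|w| <= (al + be) * q + al * (A - B) ^+ 2.
    have := ler_wpM2l (proj1 (andP p1)) h.
    by have := scale _ _ P0 (lexx _); lra_p.
  rewrite -ler_sqr ?nnegrE ?addr_ge0// ?mulr_ge0 ?subr_ge0//.
  rewrite exprMn real_normK ?num_real// wE.
  (* w^2 is at most 2 A B q, so after squaring it is enough to bound
     (be - al)^2 A B by al (al + be) (A - B)^2; h1 and h2 give this bound as a
     product. *)
  have h1 : (be - al) * B <= al * (A - B) by lra_p.
  have h2 : (be - al) * A <= (al + be) * (A - B).
    suff: (al + be) * B <= 2 * (al * A) by lra_p.
    by have := ler_wpM2l al0 BA; lra_p.
  have h3 : ((be - al) * B) * ((be - al) * A) <= al * (A - B) * ((al + be) * (A - B)).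
    by apply: ler_pM => //; rewrite mulr_ge0 ?subr_ge0// (le_trans B0).
  have h4 := ler_wpM2l q0 h3.
  have := mulr_ge0 P0 Q0; have := sqr_ge0 ((al + be) * q).
  have := sqr_ge0 (al * (A - B) ^+ 2); have := sqr_ge0 ((be - al) * q).
  by lra_p.
have h : 2 * (al * q) <= (al + be) * q by have := ler_wpM2r q0 ab; lra_p.
by have := scale _ _ (_ : 0 <= 2 * (al * q)) h; rewrite !mulr_ge0// => /(_ isT); lra_p.
Qed.

Lemma forms_bound_ordered a1 a2 b1 b2 : modulus b1 b2 <= modulus a1 a2 ->
  (p - 1) * `|skew_form a1 a2 b1 b2| <= monotone_form a1 a2 b1 b2 /\
  (p - 1) * (phi_weight a1 a2 * ((a1 - b1) ^+ 2 + (a2 - b2) ^+ 2)) <=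
    monotone_form a1 a2 b1 b2.
Proof.
move=> BA; rewrite /skew_form /monotone_form.
set al := phi_weight a1 a2; set be := phi_weight b1 b2.
set A := modulus a1 a2 in BA *; set B := modulus b1 b2 in BA *.
have A0 : 0 <= A := modulus_ge0 _ _.
have B0 : 0 <= B := modulus_ge0 _ _.
have al0 : 0 <= al := powR_ge0 _ _.
have EA : A ^+ 2 = a1 ^+ 2 + a2 ^+ 2 := modulus_sqr _ _.
have EB : B ^+ 2 = b1 ^+ 2 + b2 ^+ 2 := modulus_sqr _ _.
(* If b = 0 the skew form vanishes and the monotone form is |a|^p. *)
have [B_eq0|B_neq0] := eqVneq B 0.
  have [-> ->] := modulus_eq0 B_eq0; rewrite !mulr0 !subr0.
  have D0 : 0 <= al * (a1 ^+ 2 + a2 ^+ 2).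
    by rewrite mulr_ge0// addr_ge0 ?sqr_ge0.
  rewrite (_ : a1 * (al * a2) - a2 * (al * a1) = 0) ?normr0 ?mulr0; last by ring.
  rewrite (_ : a1 * (al * a1) + a2 * (al * a2) = al * (a1 ^+ 2 + a2 ^+ 2)); last by ring.
  by split=> //; rewrite -[leRHS]mul1r ler_wpM2r//; lra_p.
have B_gt0 : 0 < B by rewrite lt_neqAle eq_sym B_neq0.
have BA' : 0 < B <= A by rewrite B_gt0.
have inc := power_increment BA'.
have anti := power_weight_antimono BA'.
rewrite -/(phi_weight a1 a2) -/al -/(phi_weight b1 b2) -/be in inc anti.
have bBaA : be * B <= al * A.
  rewrite -subr_ge0; apply: le_trans inc.
  by rewrite !mulr_ge0 ?subr_ge0//; lra_p.
pose q := A * B - (a1 * b1 + a2 * b2).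
have q0 : 0 <= q by rewrite subr_ge0 dot_le_modulus.
pose w := a1 * b2 - a2 * b1.
have wE : w ^+ 2 = q * (2 * A * B - q).
  rewrite (_ : q * _ = A ^+ 2 * B ^+ 2 - (a1 * b1 + a2 * b2) ^+ 2); last by rewrite /q; ring.
  by rewrite EA EB /w; ring.
have [] := monotone_form_lower_bounds _ _ bBaA inc q0 wE; rewrite ?al0 ?B0//.
have -> : (al * A - be * B) * (A - B) + (al + be) * q =
   (a1 - b1) * (al * a1 - be * b1) + (a2 - b2) * (al * a2 - be * b2).
  have -> : (al * A - be * B) * (A - B) + (al + be) * q =
   al * A ^+ 2 + be * B ^+ 2 - (al + be) * (a1 * b1 + a2 * b2) by rewrite /q; ring.
  by rewrite EA EB; ring.
have -> : (A - B) ^+ 2 + 2 * q = (a1 - b1) ^+ 2 + (a2 - b2) ^+ 2.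
  have -> : (A - B) ^+ 2 + 2 * q = A ^+ 2 + B ^+ 2 - 2 * (a1 * b1 + a2 * b2)
    by rewrite /q; ring.
  by rewrite EA EB; ring.
have -> : (be - al) * `|w| = `|(a1 - b1) * (al * a2 - be * b2) - (a2 - b2) * (al * a1 - be * b1)|.
  rewrite -[be - al]ger0_norm ?subr_ge0// -normrM -normrN; congr `| _ |.
  by rewrite /w; ring.
by [].
Qed.

Lemma monotone_formC a1 a2 b1 b2 : monotone_form a1 a2 b1 b2 = monotone_form b1 b2 a1 a2.
Proof. by rewrite /monotone_form; ring. Qed.

Lemma skew_formC a1 a2 b1 b2 : skew_form a1 a2 b1 b2 = skew_form b1 b2 a1 a2.
Proof. by rewrite /skew_form; ring. Qed.

(** The numerical range of the form is contained in a sector, which is what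
    makes the semigroup analytic on l^p. *)
Lemma skew_form_le a1 a2 b1 b2 :
  (p - 1) * `|skew_form a1 a2 b1 b2| <= monotone_form a1 a2 b1 b2.
Proof.
case: (leP (modulus b1 b2) (modulus a1 a2)) => [|/ltW] /forms_bound_ordered[]//.
by rewrite skew_formC monotone_formC.
Qed.

(** Rotating by z = x + i y keeps the form accretive as long as z stays in the
    sector dual to that of [skew_form_le]. *)
Lemma sector_form_ge0 x y a1 a2 b1 b2 : `|y| <= (p - 1) * x ->
  0 <= x * monotone_form a1 a2 b1 b2 + y * skew_form a1 a2 b1 b2.
Proof.
move=> yx; set M := monotone_form _ _ _ _; set S := skew_form _ _ _ _.
have SM : (p - 1) * `|S| <= M := skew_form_le _ _ _ _.
have x0 : 0 <= x by have := le_trans (normr_ge0 _) yx; rewrite pmulr_rge0//; lra_p.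
have h1 : - (y * S) <= `|y| * `|S| by rewrite -normrM -normrN ler_norm.
have h2 : `|y| * `|S| <= (p - 1) * x * `|S| by rewrite ler_wpM2r.
have h3 := ler_wpM2l x0 SM; lra_p.
Qed.

(** First order expansion of |a + b|^p with an error of order |b|^p.  For
    |b| <= |a| the concavity of s -> s^(p/2), applied to s = |a + b|^2, leaves the
    error |a|^(p-2) |b|^2 <= |b|^p; for |b| > |a| every term is of order
    |b|^p. *)
Lemma modulus_powR_add a1 a2 b1 b2 :
  modulus (a1 + b1) (a2 + b2) `^ p <=
  modulus a1 a2 `^ p + p * (phi_weight a1 a2 * (a1 * b1 + a2 * b2)) +
  6 * modulus b1 b2 `^ p.
Proof.
rewrite /phi_weight; set A := modulus a1 a2; set B := modulus b1 b2.
set D := modulus (a1 + b1) (a2 + b2).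
have A0 : 0 <= A := modulus_ge0 _ _.
have B0 : 0 <= B := modulus_ge0 _ _.
have D0 : 0 <= D := modulus_ge0 _ _.
have EA : A ^+ 2 = a1 ^+ 2 + a2 ^+ 2 := modulus_sqr _ _.
have EB : B ^+ 2 = b1 ^+ 2 + b2 ^+ 2 := modulus_sqr _ _.
have ED : D ^+ 2 = A ^+ 2 + 2 * (a1 * b1 + a2 * b2) + B ^+ 2.
  by rewrite EA EB /D modulus_sqr; ring.
have p0 : 0 <= p by lra_p.
have [AB|BA] := ltP A B.
  have dot : - (A * B) <= a1 * b1 + a2 * b2.
    have := dot_le_modulus (- a1) (- a2) b1 b2.
    by rewrite /modulus !sqrrN -/A -/(modulus a1 a2) -/(modulus b1 b2) -/A -/B; lra_p.
  have D2B : D <= 2 * B.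
    rewrite -ler_sqr ?nnegrE ?mulr_ge0// ED.
    have := dot_le_modulus a1 a2 b1 b2; rewrite -/A -/B.
    have : A * B <= B ^+ 2 by rewrite expr2 ler_wpM2r// ltW.
    have : A ^+ 2 <= B ^+ 2 by rewrite ler_sqr ?nnegrE// ltW.
    lra_p.
  have h1 : D `^ p <= 4 * B `^ p.
    apply: (@le_trans _ _ ((2 * B) `^ p)).
      by rewrite ge0_ler_powR ?nnegrE ?mulr_ge0.
    rewrite powRM//; apply: ler_wpM2r; rewrite ?powR_ge0//.
    have -> : 4 = 2 `^ 2 :> R by rewrite powR_mulrn//; lra_p.
    by apply: ler_powR => //; lra_p.
  have h2 : A `^ (p - 2) * (A * B) <= B `^ p.
    rewrite mulrA power_weight_mul// -[leRHS]mulr_powRB1//; last by lra_p.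
    rewrite mulrC ler_wpM2l// ge0_ler_powR ?nnegrE// ?(ltW AB)//; lra_p.
  have h3 := ler_wpM2l (powR_ge0 A (p - 2)) dot.
  have h4 : p * B `^ p <= 2 * B `^ p by rewrite ler_wpM2r ?powR_ge0//; lra_p.
  have h5 := ler_wpM2l p0 (le_trans h3 (lexx _)).
  have h6 := ler_wpM2l p0 h2.
  have := powR_ge0 A p; lra_p.
have [A_eq0|A_neq0] := eqVneq A 0.
  have B_eq0 : B = 0 by apply/eqP; rewrite eq_le B0 andbT -A_eq0.
  have D_eq0 : D = 0.
    apply/eqP; rewrite -sqrf_eq0 ED A_eq0 B_eq0.
    have [-> ->] := modulus_eq0 A_eq0.
    by rewrite !expr0n/= !(mul0r, addr0, mulr0).
  have pN0 : p != 0 by rewrite gt_eqF//; lra_p.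
  rewrite D_eq0 A_eq0 B_eq0 (powR0 pN0).
  have [-> ->] := modulus_eq0 A_eq0.
  by rewrite !(mul0r, addr0, mulr0).
have A_gt0 : 0 < A by rewrite lt_neqAle eq_sym A_neq0.
have th01 : 0 <= p / 2 <= 1 by apply/andP; split; lra_p.
have := weighted_amgm th01 (sqr_ge0 D) (sqr_ge0 A).
rewrite -[D ^+ 2]powR_mulrn// -{1}[A ^+ 2]powR_mulrn// -!powRrM.
rewrite (_ : 2%:R * (p / 2) = p); last by field.
rewrite (_ : 2%:R * (1 - p / 2) = 2 - p); last by field.
rewrite powR_mulrn// ED => h.
have := ler_wpM2l (powR_ge0 A (p - 2)) h.
rewrite mulrCA -powRD; last by rewrite (gt_eqF A_gt0) implybT.
rewrite (_ : p - 2 + (2 - p) = 0); last by ring.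
rewrite powRr0 mulr1 => {}h; apply: (le_trans h).
have E1 := power_weight_sqr A0.
have h2 : A `^ (p - 2) * B ^+ 2 <= B `^ p.
  have [->|B_neq0] := eqVneq B 0; first by rewrite expr0n mulr0 powR_ge0.
  rewrite -power_weight_sqr// ler_wpM2r ?sqr_ge0// power_weight_antimono//.
  by rewrite lt_neqAle eq_sym B_neq0 B0.
have -> : A `^ (p - 2) * (p / 2 * (A ^+ 2 + 2 * (a1 * b1 + a2 * b2) + B ^+ 2) +
   (1 - p / 2) * A ^+ 2) = A `^ (p - 2) * A ^+ 2 +
   p * (A `^ (p - 2) * (a1 * b1 + a2 * b2)) + p / 2 * (A `^ (p - 2) * B ^+ 2) by field.
rewrite E1 lerD2l; apply: (@le_trans _ _ (1 * B `^ p)).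
  by apply: ler_pM => //; rewrite ?mulr_ge0 ?powR_ge0 ?sqr_ge0//; lra_p.
by rewrite ler_wpM2r ?powR_ge0//; lra_p.
Qed.

End Plane.

(** * Sums over a weighted graph *)

Lemma ler_sum_subset (R : numDomainType) (I : eqType) (r s : seq I) (F : I -> R) :
  uniq r -> uniq s -> {subset r <= s} -> (forall i, 0 <= F i) ->
  \sum_(i <- r) F i <= \sum_(i <- s) F i.
Proof.
move=> ur us rs F0.
have rE : perm_eq r [seq i <- s | i \in r].
  apply: uniq_perm; rewrite ?filter_uniq// => i; rewrite mem_filter.
  by case ir : (i \in r) => //=; rewrite rs.
rewrite (perm_big _ rE) big_filter big_mkcond.
by apply: ler_sum => i _; case: ifP.
Qed.

(** Hoelder against the constant function 1. *)
Lemma power_mean_sum (R : realType) (I : Type) (r : seq I) (w a : I -> R) (p : R) :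
  1 <= p -> (forall i, 0 <= w i) -> (forall i, 0 <= a i) ->
  (\sum_(i <- r) w i * a i) `^ p <=
  (\sum_(i <- r) w i) `^ (p - 1) * \sum_(i <- r) w i * a i `^ p.
Proof.
move=> p1 w0 a0; have p0 : 0 < p by lra.
have th01 : 0 <= p^-1 <= 1 by rewrite invr_ge0 invf_le1// ltW.
have h : \sum_(i <- r) w i * a i <=
    (\sum_(i <- r) w i * a i `^ p) `^ p^-1 * (\sum_(i <- r) w i) `^ (1 - p^-1).
  have := hoelder_sum r th01 w0 (fun i => powR_ge0 (a i) p) (fun=> ler01).
  under eq_bigr do rewrite -powRrM mulfV ?gt_eqF// powRr1// powR1 mulr1.
  by under [X in _ * X `^ _]eq_bigr do rewrite mulr1.
have S0 : 0 <= \sum_(i <- r) w i * a i `^ p.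
  by apply: sumr_ge0 => i _; rewrite mulr_ge0 ?powR_ge0.
have W0 : 0 <= \sum_(i <- r) w i by apply: sumr_ge0.
apply: le_trans (ge0_ler_powR (ltW p0) _ _ h) _; rewrite ?nnegrE.
- by apply: sumr_ge0 => i _; rewrite mulr_ge0.
- by rewrite mulr_ge0 ?powR_ge0.
rewrite powRM ?powR_ge0// -!powRrM mulVf ?gt_eqF// powRr1// mulrBl mul1r.
by rewrite mulVf ?gt_eqF// mulrC.
Qed.

Section GraphSums.
Variables (R : realType) (V : choiceType) (G : weighted_graph R V).
Implicit Types (f g : V -> R) (A : set V) (S : {fset V}).

Lemma mu_ge0 x y : 0 <= mu G x y.
Proof. by rewrite /mu; case: ifPn => // /set_mem /ew_gt0 /ltW. Qed.

Lemma mu_neq0_edge x y : mu G x y != 0 -> edges G [set x; y].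
Proof. by rewrite /mu; case: ifPn => [/set_mem//|]; rewrite eqxx. Qed.

Lemma fsum_fset (F : V -> R) S : (forall x, x \notin S -> F x = 0) ->
  \sum_(x \in [set: V]) F x = \sum_(x <- S) F x.
Proof.
move=> F0; rewrite -(fsbig_widen [set` S]) ?fsbig_finite ?set_fsetK//.
by move=> x [_ /= /negP]; exact: F0.
Qed.

(** For functions supported in A, sums over the vertices, including those that
    involve the Laplacian, reduce to sums over such a finite set S. *)
Definition nbhd_of A S :=
  forall x, A x -> x \in S /\ forall y, mu G x y != 0 -> y \in S.

Lemma nbhd_exists A : finite_set A -> exists S, nbhd_of A S.
Proof.
move=> finA.
have fin : finite_set (A `|` \bigcup_(x in A) [set y | edges G [set x; y]]).
  rewrite finite_setU; split=> //.
  by apply: bigcup_finite => // x _; exact: locally_finite.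
exists (fset_set (A `|` \bigcup_(x in A) [set y | edges G [set x; y]])) => x Ax.
rewrite in_fset_set//; split; first by apply/mem_set; left.
move=> y /mu_neq0_edge exy; rewrite in_fset_set//; apply/mem_set; right.
by exists x.
Qed.

Definition supported f A := forall x, ~ A x -> f x = 0.

Lemma finitely_supportedP f A : finite_set A -> supported f A -> finitely_supported f.
Proof.
move=> finA fA; apply: sub_finite_set finA => x /= /eqP fx.
by apply: contrapT => /fA.
Qed.

Lemma supported_support f : supported f [set x | f x != 0].
Proof. by move=> x /= /negP; rewrite negbK => /eqP. Qed.

Lemma supported_notin f A S x : nbhd_of A S -> supported f A -> x \notin S -> f x = 0.
Proof. by move=> AS fA xS; apply: fA => /AS[]; rewrite (negbTE xS). Qed.

(** The identity holds at every vertex x, not only for x in A: away from A only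
    neighbours lying in A contribute. *)
Lemma laplacian_fset f A S x : nbhd_of A S -> supported f A ->
  laplacian G f x = (nu G x)^-1 * \sum_(y <- S) mu G x y * (f x - f y).
Proof.
move=> AS fA; rewrite /laplacian; congr (_ * _); apply: fsum_fset => y yS.
rewrite (supported_notin AS fA yS) subr0.
have [Ax|/fA ->] := pselect (A x); last by rewrite mulr0.
have [->|m0] := eqVneq (mu G x y) 0; first by rewrite mul0r.
by have [_ /(_ y m0)] := AS x Ax; rewrite (negbTE yS).
Qed.

Lemma laplacian_notin f A S x : nbhd_of A S -> supported f A ->
  x \notin S -> laplacian G f x = 0.
Proof.
move=> AS fA xS; rewrite (laplacian_fset _ AS fA) big1 ?mulr0// => y _.
rewrite (supported_notin AS fA xS) sub0r.
have [Ay|/fA ->] := pselect (A y); last by rewrite oppr0 mulr0.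
have [->|m0] := eqVneq (mu G x y) 0; first by rewrite mul0r.
by have [_ /(_ x)] := AS y Ay; rewrite muC => /(_ m0); rewrite (negbTE xS).
Qed.

Lemma finitely_supported_laplacian f :
  finitely_supported f -> finitely_supported (laplacian G f).
Proof.
move=> ff; have [S AS] := nbhd_exists ff.
apply: (@finitely_supportedP _ [set` S]); first exact: finite_fset.
by move=> x /negP; exact: laplacian_notin AS (@supported_support f).
Qed.

Lemma sum_mu_le_deg S x : \sum_(y <- S) mu G x y <= deg G x.
Proof.
have fin := locally_finite G x.
set N := fset_set [set y | edges G [set x; y]].
rewrite /deg (@fsum_fset _ (S `|` N)%fset); last first.
  move=> y; rewrite in_fsetU negb_or => /andP[_].
  rewrite in_fset_set// => /negP yN; apply/eqP; apply: contrapT => /negP m0.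
  by apply: yN; apply/mem_set; exact: mu_neq0_edge.
apply: ler_sum_subset; rewrite ?fset_uniq//; last exact: mu_ge0.
by move=> y yS; rewrite in_fsetU yS.
Qed.

Lemma sum_mu_fst_le (M : R) S g : (forall x, deg G x <= M * nu G x) ->
  (forall x, 0 <= g x) ->
  \sum_(x <- S) \sum_(y <- S) mu G x y * g x <= M * \sum_(x <- S) nu G x * g x.
Proof.
move=> hM g0; rewrite mulr_sumr; apply: ler_sum => x _.
rewrite -mulr_suml mulrA ler_wpM2r// (le_trans _ (hM x))//.
exact: sum_mu_le_deg.
Qed.

Lemma sum_mu_sndE S g :
  \sum_(x <- S) \sum_(y <- S) mu G x y * g y =
  \sum_(x <- S) \sum_(y <- S) mu G x y * g x.
Proof.
rewrite exchange_big/=; apply: eq_bigr => x _; apply: eq_bigr => y _.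
by rewrite muC.
Qed.

(** Symmetrise the sum of mu x y (f x - f y) g x in x and y. *)
Lemma green_formula f g A S : nbhd_of A S -> supported f A -> supported g A ->
  \sum_(x <- S) nu G x * (laplacian G f x * g x) =
  2^-1 * \sum_(x <- S) \sum_(y <- S) mu G x y * ((f x - f y) * (g x - g y)).
Proof.
move=> AS fA gA.
have E : \sum_(x <- S) nu G x * (laplacian G f x * g x) =
    \sum_(x <- S) \sum_(y <- S) mu G x y * ((f x - f y) * g x).
  apply: eq_bigr => x _; rewrite (laplacian_fset _ AS fA) !mulrA.
  rewrite mulfV ?mul1r ?gt_eqF ?nu_gt0// mulr_suml.
  by apply: eq_bigr => y _; rewrite mulrA.
(* The same sum after exchanging the names of x and y. *)
have E' : \sum_(x <- S) nu G x * (laplacian G f x * g x) =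
    \sum_(x <- S) \sum_(y <- S) mu G x y * ((f x - f y) * - g y).
  rewrite E exchange_big/=; apply: eq_bigr => x _; apply: eq_bigr => y _.
  by rewrite muC; ring.
apply: (@mulfI _ 2) => //; rewrite mulrA mulfV// mul1r mulr2n mulrDl mul1r.
rewrite {1}E E' -big_split/=; apply: eq_bigr => x _.
by rewrite -big_split/=; apply: eq_bigr => y _; ring.
Qed.

(** The p-th power of the l^p norm. *)
Definition lp_mass (p : R) g : R := \sum_(x \in [set: V]) nu G x * `|g x| `^ p.

Lemma lp_mass_fset p g S : p != 0 -> (forall x, x \notin S -> g x = 0) ->
  lp_mass p g = \sum_(x <- S) nu G x * `|g x| `^ p.
Proof. by move=> p0 g0; apply: fsum_fset => x /g0 ->; rewrite normr0 powR0 ?mulr0. Qed.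

Lemma lp_mass_ge0 p g : 0 <= lp_mass p g.
Proof. by apply: fsumr_ge0 => x _; rewrite mulr_ge0 ?powR_ge0// ltW ?nu_gt0. Qed.

(** Delta f x is an average of the differences f x - f y with weights of total
    mass at most M, so the power mean inequality applies vertex by vertex. *)
Lemma lp_mass_laplacian (M p : R) f : (forall x, deg G x <= M * nu G x) -> 0 <= M ->
  1 < p -> p <= 2 -> finitely_supported f ->
  lp_mass p (laplacian G f) <= 8 * M `^ p * lp_mass p f.
Proof.
move=> hM M0 p1 p2 ff; have pN0 : p != 0 by rewrite gt_eqF//; lra.
have [S AS] := nbhd_exists ff; have fA := @supported_support f.
rewrite (lp_mass_fset pN0 (fun x => laplacian_notin AS fA)).
rewrite (lp_mass_fset pN0 (fun x => supported_notin AS fA)).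
pose g x := `|f x| `^ p.
have g0 x : 0 <= g x by exact: powR_ge0.
have pt x : nu G x * `|laplacian G f x| `^ p <=
    M `^ (p - 1) * (4 * \sum_(y <- S) mu G x y * (g x + g y)).
  rewrite (laplacian_fset _ AS fA) normrM.
  have n0 := nu_gt0 G x; rewrite gtr0_norm ?invr_gt0//.
  have T0 : 0 <= \sum_(y <- S) mu G x y * `|f x - f y|.
    by apply: sumr_ge0 => y _; rewrite mulr_ge0// mu_ge0.
  have h1 : `|\sum_(y <- S) mu G x y * (f x - f y)| <=
      \sum_(y <- S) mu G x y * `|f x - f y|.
    apply: le_trans (ler_norm_sum _ _ _) _; apply: ler_sum => y _.
    by rewrite normrM ger0_norm ?mu_ge0.
  have h2 : (\sum_(y <- S) mu G x y * `|f x - f y|) `^ p <=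
      (M * nu G x) `^ (p - 1) * (4 * \sum_(y <- S) mu G x y * (g x + g y)).
    apply: le_trans (power_mean_sum _ (ltW p1) (mu_ge0 x) (fun=> normr_ge0 _)) _.
    apply: ler_pM; rewrite ?powR_ge0//.
    - by apply: sumr_ge0 => y _; rewrite mulr_ge0 ?powR_ge0 ?mu_ge0.
    - rewrite ge0_ler_powR ?nnegrE ?mulr_ge0 ?(ltW n0)//; first by lra.
        by apply: sumr_ge0 => y _; exact: mu_ge0.
      exact: le_trans (sum_mu_le_deg _ _) (hM x).
    - rewrite mulr_sumr; apply: ler_sum => y _.
      rewrite mulrCA ler_wpM2l ?mu_ge0//.
      have p02 : 0 <= p <= 2 by apply/andP; split; lra.
      apply: le_trans (powR_add_le p02 (normr_ge0 (f x)) (normr_ge0 (f y))).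
      by rewrite ge0_ler_powR ?nnegrE ?addr_ge0 ?ler_normB//; lra.
  rewrite powRM ?invr_ge0 ?(ltW n0)//.
  apply: (@le_trans _ _ (nu G x * ((nu G x)^-1 `^ p *
      ((M * nu G x) `^ (p - 1) * (4 * \sum_(y <- S) mu G x y * (g x + g y)))))).
    rewrite !ler_wpM2l ?powR_ge0 ?(ltW n0)//; apply: le_trans h2.
    by rewrite ge0_ler_powR ?nnegrE//; lra.
  rewrite le_eqVlt; apply/orP; left; apply/eqP.
  rewrite powRM ?(ltW n0)// -powR_inv1 ?(ltW n0)// -powRrM mulN1r.
  have E : nu G x * (nu G x `^ (- p) * nu G x `^ (p - 1)) = 1.
    rewrite -powRD ?(gt_eqF n0) ?implybT// (_ : - p + (p - 1) = -1); last by ring.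
    by rewrite powR_inv1 ?(ltW n0)// mulfV// gt_eqF.
  transitivity ((nu G x * (nu G x `^ (- p) * nu G x `^ (p - 1))) *
     (M `^ (p - 1) * (4 * \sum_(y <- S) mu G x y * (g x + g y)))); first by ring.
  by rewrite E mul1r.
apply: le_trans (ler_sum _ (fun x _ => pt x)) _.
rewrite -!mulr_sumr.
under eq_bigr do (under eq_bigr do rewrite mulrDr; rewrite big_split/=).
rewrite big_split/= sum_mu_sndE.
have h := sum_mu_fst_le S hM g0.
rewrite -(@mulr_powRB1 _ M p)//; last by lra.
have P0 : 0 <= M `^ (p - 1) by exact: powR_ge0.
have := ler_wpM2l P0 h; rewrite /g; lra.
Qed.

End GraphSums.

(** * The gradient estimate *)

(** The real case of the coercivity bound, in a form symmetric in a and b. *)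
Lemma monotone_form_real_ge (R : realType) (p a b : R) : 1 < p -> p <= 2 ->
  (p - 1) * (Num.max `|a| `|b| `^ (p - 2) * (a - b) ^+ 2) <=
  monotone_form p a 0 b 0.
Proof.
move=> p1 p2.
wlog ab : a b / `|b| <= `|a|.
  move=> h; case: (leP `|b| `|a|) => [ab|/ltW ba].
    by have := h a b ab; rewrite (max_idPl ab).
  by have := h b a ba; rewrite (max_idPl ba) monotone_formC -sqrrN opprB.
rewrite (max_idPl ab); rewrite -!modulus_real in ab *.
have [_] := forms_bound_ordered p1 p2 ab.
by rewrite subr0 expr0n addr0.
Qed.

Definition gradient_const (R : realType) (p M : R) : R :=
  (2 / (p - 1)) `^ (p / 2) * (2 * M) `^ (1 - p / 2).

(** The exponents of u add up to 1/2, since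
    (1 - 1/p) (p/2) + (1 - p/2) = 1/2. *)
Lemma gradient_exponents (R : realType) (p M u v X Y : R) :
  1 < p -> p <= 2 -> 0 <= M -> 0 <= u -> 0 <= v -> 0 <= X -> 0 <= Y ->
  X <= 2 / (p - 1) * (v `^ p^-1 * u `^ (1 - p^-1)) -> Y <= 2 * M * u ->
  X `^ (p / 2) * Y `^ (1 - p / 2) <= gradient_const p M * (u * v) `^ 2^-1.
Proof.
move=> p1 p2 M0 u0 v0 X0 Y0 hX hY.
have p0 : 0 < p by lra.
have pN0 : p != 0 by rewrite gt_eqF.
have c0 : 0 <= 2 / (p - 1) by rewrite divr_ge0//; lra.
have e0 : 0 <= 1 - p / 2 by lra.
have e1 : p / 2 - 2^-1 + (1 - p / 2) = 2^-1 by field.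
have vu0 : 0 <= v `^ p^-1 * u `^ (1 - p^-1) by rewrite mulr_ge0 ?powR_ge0.
have Mu0 : 0 <= 2 * M by rewrite mulr_ge0.
have XB : X `^ (p / 2) <= (2 / (p - 1) * (v `^ p^-1 * u `^ (1 - p^-1))) `^ (p / 2).
  by rewrite ge0_ler_powR ?nnegrE ?(le_trans X0 hX)//; lra.
have YB : Y `^ (1 - p / 2) <= (2 * M * u) `^ (1 - p / 2).
  by rewrite ge0_ler_powR ?nnegrE ?(le_trans Y0 hY).
apply: le_trans (ler_pM (powR_ge0 _ _) (powR_ge0 _ _) XB YB) _.
rewrite (powRM _ c0 vu0) (powRM _ Mu0 u0) (powRM _ (powR_ge0 _ _) (powR_ge0 _ _)).
rewrite -!powRrM (powRM _ u0 v0).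
rewrite (_ : p^-1 * (p / 2) = 2^-1); last by field.
rewrite (_ : (1 - p^-1) * (p / 2) = p / 2 - 2^-1); last by field.
have -> : u `^ 2^-1 = u `^ (p / 2 - 2^-1) * u `^ (1 - p / 2).
  by rewrite -powRD e1// invr_eq0 pnatr_eq0.
by rewrite /gradient_const le_eqVlt; apply/orP; left; apply/eqP; ring.
Qed.

Section GradientEstimate.
Variables (R : realType) (V : choiceType) (G : weighted_graph R V).
Implicit Types (f : V -> R) (S : {fset V}).

(** Green's formula turns the sum into the pairing of Delta f with phi(f), and
    |phi(f)| = |f|^(p-1) makes Hoelder with exponents p and p/(p-1) apply. *)
Lemma energy_le_lp_mass (p : R) f : 1 < p -> p <= 2 -> finitely_supported f ->
  forall S, nbhd_of G [set x | f x != 0] S ->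
  \sum_(x <- S) \sum_(y <- S) mu G x y * monotone_form p (f x) 0 (f y) 0 <=
  2 * (lp_mass G p (laplacian G f) `^ p^-1 * lp_mass G p f `^ (1 - p^-1)).
Proof.
move=> p1 p2 ff S AS; have fA := @supported_support R V f.
have p0 : 0 < p by lra.
have pN0 : p != 0 by rewrite gt_eqF.
pose h x := phi_weight p (f x) 0 * f x.
have hA : supported h [set x | f x != 0] by move=> x /fA fx; rewrite /h fx mulr0.
have -> : \sum_(x <- S) \sum_(y <- S) mu G x y * monotone_form p (f x) 0 (f y) 0 =
    2 * \sum_(x <- S) nu G x * (laplacian G f x * h x).
  rewrite (green_formula AS fA hA) mulrA mulfV// mul1r.
  apply: eq_bigr => x _; apply: eq_bigr => y _.
  by rewrite /monotone_form subrr mul0r addr0.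
apply: ler_wpM2l => //.
have th01 : 0 <= p^-1 <= 1 by rewrite invr_ge0 invf_le1// !ltW.
rewrite (lp_mass_fset G pN0 (fun x => laplacian_notin AS fA)).
rewrite (lp_mass_fset G pN0 (fun x => supported_notin AS fA)).
apply: le_trans (hoelder_sum _ th01 (fun x => ltW (nu_gt0 G x))
  (fun x => powR_ge0 _ _) (fun x => powR_ge0 _ _)).
apply: ler_sum => x _; rewrite ler_wpM2l ?(ltW (nu_gt0 G x))//.
rewrite -!powRrM mulfV// powRr1// (_ : p * (1 - p^-1) = p - 1); last first.
  by rewrite mulrBr mulr1 mulfV.
apply: le_trans (ler_norm _) _.
rewrite normrM ler_wpM2l// /h normrM ger0_norm ?powR_ge0//.
by rewrite /phi_weight modulus_real power_weight_mul.
Qed.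

(** Write |f x - f y|^p as
    (m^(p-2) |f x - f y|^2)^(p/2) (m^p)^(1-p/2) with m = max(|f x|, |f y|) and
    apply Hoelder: the first factor is the energy, the second one is bounded
    through the degrees. *)
Lemma gradient_pair_sum_le (M p : R) f : (forall x, deg G x <= M * nu G x) ->
  0 <= M -> 1 < p -> p <= 2 -> finitely_supported f ->
  forall S, nbhd_of G [set x | f x != 0] S ->
  \sum_(x <- S) \sum_(y <- S) mu G x y * `|f x - f y| `^ p <=
  gradient_const p M * (lp_mass G p f * lp_mass G p (laplacian G f)) `^ 2^-1.
Proof.
move=> hM M0 p1 p2 ff S AS; have fA := @supported_support R V f.
have p0 : 0 < p by lra.
have pN0 : p != 0 by rewrite gt_eqF.
have p1_gt0 : 0 < p - 1 by lra.
have c0 : 0 <= 2 / (p - 1) by rewrite divr_ge0// ltW.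
pose m x y := Num.max `|f x| `|f y|.
have m0 x y : 0 <= m x y by rewrite le_max normr_ge0.
have fm x y : `|f x - f y| <= 2 * m x y.
  apply: le_trans (ler_normB _ _) _; rewrite mulr2n mulrDl mul1r lerD//.
    by rewrite le_max lexx.
  by rewrite le_max lexx orbT.
pose L := [seq (x, y) | x <- S, y <- S].
have E (F : V -> V -> R) : \sum_(x <- S) \sum_(y <- S) F x y = \sum_(z <- L) F z.1 z.2.
  by rewrite big_allpairs.
have th01 : 0 <= p / 2 <= 1 by apply/andP; split; lra.
have p2N0 : p / 2 != 0 by rewrite gt_eqF//; lra.
have pt x y : `|f x - f y| `^ p <=
    (m x y `^ (p - 2) * (f x - f y) ^+ 2) `^ (p / 2) * (m x y `^ p) `^ (1 - p / 2).
  have [mxy|mxy] := eqVneq (m x y) 0.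
    have -> : f x - f y = 0.
      by apply/eqP; rewrite -normr_le0; have := fm x y; rewrite mxy mulr0.
    by rewrite normr0 powR0// mulr_ge0 ?powR_ge0.
  rewrite powRM ?powR_ge0 ?sqr_ge0// -!powRrM mulrAC -powRD ?mxy ?implybT//.
  rewrite (_ : (p - 2) * (p / 2) + p * (1 - p / 2) = 0); last by field.
  rewrite powRr0 mul1r -real_normK ?num_real// -powR_mulrn// -powRrM.
  by rewrite (_ : 2%:R * (p / 2) = p)//; field.
set u := lp_mass G p f; set v := lp_mass G p (laplacian G f).
have u0 : 0 <= u := lp_mass_ge0 _ _ _.
have v0 : 0 <= v := lp_mass_ge0 _ _ _.
set X := \sum_(z <- L) mu G z.1 z.2 * (m z.1 z.2 `^ (p - 2) * (f z.1 - f z.2) ^+ 2).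
set Y := \sum_(z <- L) mu G z.1 z.2 * (m z.1 z.2 `^ p).
have hXY : \sum_(x <- S) \sum_(y <- S) mu G x y * `|f x - f y| `^ p <=
    X `^ (p / 2) * Y `^ (1 - p / 2).
  rewrite E; apply: le_trans (hoelder_sum L th01 (fun z => mu_ge0 G z.1 z.2) _ _).
  - by apply: ler_sum => z _; rewrite ler_wpM2l ?mu_ge0.
  - by move=> z; rewrite mulr_ge0 ?powR_ge0 ?sqr_ge0.
  - by move=> z; exact: powR_ge0.
have X0 : 0 <= X.
  by apply: sumr_ge0 => z _; rewrite mulr_ge0 ?mu_ge0// mulr_ge0 ?powR_ge0 ?sqr_ge0.
have Y0 : 0 <= Y by apply: sumr_ge0 => z _; rewrite mulr_ge0 ?mu_ge0 ?powR_ge0.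
have hX : X <= 2 / (p - 1) * (v `^ p^-1 * u `^ (1 - p^-1)).
  rewrite mulrAC ler_pdivlMr//.
  apply: le_trans (energy_le_lp_mass p1 p2 ff AS).
  rewrite E mulr_suml; apply: ler_sum => z _.
  rewrite -mulrA ler_wpM2l ?mu_ge0// mulrC.
  exact: monotone_form_real_ge.
have hY : Y <= 2 * M * u.
  rewrite /Y -(E (fun x y => mu G x y * m x y `^ p)).
  have h := sum_mu_fst_le S hM (fun x => powR_ge0 `|f x| p).
  rewrite /u (lp_mass_fset G pN0 (fun x => supported_notin AS fA)).
  apply: (@le_trans _ _ (\sum_(x <- S) \sum_(y <- S) mu G x y * `|f x| `^ p +
      \sum_(x <- S) \sum_(y <- S) mu G x y * `|f y| `^ p)).
    rewrite -big_split/=; apply: ler_sum => x _.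
    rewrite -big_split/=; apply: ler_sum => y _.
    rewrite -mulrDr ler_wpM2l ?mu_ge0// /m.
    by case: (leP `|f x| `|f y|) => _; rewrite ?lerDl ?lerDr powR_ge0.
  rewrite (sum_mu_sndE G S (fun y => `|f y| `^ p)) -mulr2n -[leLHS]mulr_natl -mulrA.
  by rewrite ler_wpM2l.
apply: le_trans hXY _.
exact: gradient_exponents.
Qed.

(** Choosing an ordered pair of end points for each edge is an injection of the
    edges into the pairs of vertices. *)
Lemma edge_sum_le_pair_sum (p : R) f (F : {fset set V}) S : p != 0 ->
  nbhd_of G [set x | f x != 0] S -> {subset F <= edges G} ->
  \sum_(e <- F) ew G e * absD f e `^ p <=
  \sum_(x <- S) \sum_(y <- S) mu G x y * `|f x - f y| `^ p.
Proof.
move=> p0 AS FE; have fA := @supported_support R V f.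
have [[z0 _]|noz] := pselect (exists z : V * V, True); last first.
  rewrite big_seq big1 => [|e /FE/set_mem/edgesP[x _]]; last by case: noz; exists (x, x).
  apply: sumr_ge0 => x _; apply: sumr_ge0 => y _.
  by rewrite mulr_ge0 ?mu_ge0 ?powR_ge0.
pose g (e : set V) := xget z0 [set z | e = [set z.1; z.2]].
have gP e : e \in F -> e = [set (g e).1; (g e).2].
  move=> /FE/set_mem/edgesP[x [y exy]].
  exact: (@xgetPex _ z0 [set z : V * V | e = [set z.1; z.2]]
    (ex_intro _ (x, y) exy)).
pose K (z : V * V) := mu G z.1 z.2 * `|f z.1 - f z.2| `^ p.
have K0 z : 0 <= K z by rewrite mulr_ge0 ?mu_ge0 ?powR_ge0.
pose L := [seq (x, y) | x <- S, y <- S].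
have -> : \sum_(x <- S) \sum_(y <- S) mu G x y * `|f x - f y| `^ p = \sum_(z <- L) K z.
  by rewrite big_allpairs.
have -> : \sum_(e <- F) ew G e * absD f e `^ p = \sum_(z <- [seq g e | e <- F]) K z.
  rewrite big_map big_seq [RHS]big_seq; apply: eq_bigr => e eF.
  by rewrite /K /mu -(gP e eF) (FE e eF) {2}(gP e eF) absDE.
(* Only pairs with an end point in the support of f contribute. *)
have KL z : z \notin L -> K z = 0.
  case: z => x y zL; rewrite /K/=; apply/eqP; apply: contraNT zL.
  rewrite mulf_eq0 negb_or => /andP[m0 d0].
  suff [xS yS] : x \in S /\ y \in S by apply/allpairsP; exists (x, y).
  have [fx|fx] := eqVneq (f x) 0; last by have [-> /(_ y m0)] := AS x fx.
  have [fy|fy] := eqVneq (f y) 0.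
    by move: d0; rewrite fx fy subrr normr0 powR0// eqxx.
  by have [-> /(_ x)] := AS y fy; rewrite muC => /(_ m0).
rewrite (bigID (mem L))/= [X in _ + X]big1 ?addr0 => [|z]; last exact: KL.
rewrite -big_filter; apply: ler_sum_subset => //.
- rewrite filter_uniq// map_inj_in_uniq ?fset_uniq// => e e' eF e'F ge.
  by rewrite (gP e eF) ge -gP.
- by apply: allpairs_uniq; rewrite ?fset_uniq// => -[? ?] [? ?].
- by move=> z; rewrite mem_filter => /andP[].
Qed.

Lemma gradient_estimate (M p : R) f (F : {fset set V}) :
  (forall x, deg G x <= M * nu G x) -> 0 <= M -> 1 < p -> p <= 2 ->
  finitely_supported f -> {subset F <= edges G} ->
  \sum_(e <- F) ew G e * absD f e `^ p <=
  gradient_const p M * (lp_mass G p f * lp_mass G p (laplacian G f)) `^ 2^-1.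
Proof.
move=> hM M0 p1 p2 ff FE; have [S AS] := nbhd_exists G ff.
apply: le_trans (gradient_pair_sum_le hM M0 p1 p2 ff AS).
by apply: edge_sum_le_pair_sum => //; rewrite gt_eqF//; lra.
Qed.

End GradientEstimate.

(** * One Euler step in the sector of accretivity *)

Lemma modulus_le_add (R : realType) (a b : R) : modulus a b <= `|a| + `|b|.
Proof.
apply: modulus_le; first by rewrite addr_ge0.
rewrite -[a ^+ 2]real_normK ?num_real// -[b ^+ 2]real_normK ?num_real//.
have := mulr_ge0 (normr_ge0 a) (normr_ge0 b); lra.
Qed.

Lemma norm_le_modulus (R : realType) (a b : R) :
  `|a| <= modulus a b /\ `|b| <= modulus a b.
Proof.
split; rewrite -ler_sqr ?nnegrE ?modulus_ge0// modulus_sqr real_normK ?num_real//.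
  by rewrite lerDl sqr_ge0.
by rewrite lerDr sqr_ge0.
Qed.

Section SectorStep.
Variables (R : realType) (V : choiceType) (G : weighted_graph R V).
Implicit Types (f : V -> R).

(** The first order term in [sector_step]: Green's formula turns it into minus a
    sum of the forms of [sector_form_ge0]. *)
Lemma dissipation (p x y : R) (f1 f2 : V -> R) A S : 1 < p -> p <= 2 ->
  `|y| <= (p - 1) * x ->
  nbhd_of G A S -> supported f1 A -> supported f2 A ->
  \sum_(v <- S) nu G v * (phi_weight p (f1 v) (f2 v) *
    (f1 v * (- (x * laplacian G f1 v) + y * laplacian G f2 v) +
     f2 v * (- (x * laplacian G f2 v) - y * laplacian G f1 v))) <= 0.
Proof.
move=> p1 p2 yx AS f1A f2A.
pose h1 v := phi_weight p (f1 v) (f2 v) * f1 v.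
pose h2 v := phi_weight p (f1 v) (f2 v) * f2 v.
have h1A : supported h1 A by move=> v /f1A E; rewrite /h1 E mulr0.
have h2A : supported h2 A by move=> v /f2A E; rewrite /h2 E mulr0.
rewrite (eq_bigr (fun v => - x * (nu G v * (laplacian G f1 v * h1 v)) +
  - x * (nu G v * (laplacian G f2 v * h2 v)) +
  - y * (nu G v * (laplacian G f1 v * h2 v)) +
  y * (nu G v * (laplacian G f2 v * h1 v)))); last by move=> v _; rewrite /h1 /h2; ring.
rewrite !big_split/= -!mulr_sumr !(green_formula AS)//.
pose B (g h : V -> R) := \sum_(v <- S) \sum_(w <- S) mu G v w * ((g v - g w) * (h v - h w)).
rewrite -/(B f1 h1) -/(B f2 h2) -/(B f1 h2) -/(B f2 h1).
have formE : \sum_(v <- S) \sum_(w <- S) mu G v w *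
    (x * monotone_form p (f1 v) (f2 v) (f1 w) (f2 w) +
     y * skew_form p (f1 v) (f2 v) (f1 w) (f2 w)) =
    x * B f1 h1 + x * B f2 h2 + y * B f1 h2 + - y * B f2 h1.
  rewrite /B !mulr_sumr -!big_split/=; apply: eq_bigr => v _.
  rewrite !mulr_sumr -!big_split/=; apply: eq_bigr => w _.
  by rewrite /monotone_form /skew_form /h1 /h2; ring.
have form_ge0 : 0 <= x * B f1 h1 + x * B f2 h2 + y * B f1 h2 + - y * B f2 h1.
  rewrite -formE; apply: sumr_ge0 => v _; apply: sumr_ge0 => w _.
  by rewrite mulr_ge0 ?mu_ge0// sector_form_ge0.
move: (B f1 h1) (B f2 h2) (B f1 h2) (B f2 h1) form_ge0 => b1 b2 b3 b4 form_ge0.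
rewrite -oppr_ge0 (_ : - _ = 2^-1 * (x * b1 + x * b2 + y * b3 + - y * b4)).
  by rewrite mulr_ge0.
by ring.
Qed.

(** One Euler step f -> f - z Delta f with z = x + i y in the sector.  In the
    expansion [modulus_powR_add] the first order term is nonpositive after
    summation, and only the error term remains.  The constant is
    384 = 6 * 4 * (8 + 8): 6 from the expansion, 4 from separating real and
    imaginary parts, 8 from the bound on Delta for each of them. *)
Lemma sector_step (p M x y s : R) (f1 f2 : V -> R) :
  (forall v, deg G v <= M * nu G v) -> 0 <= M -> 1 < p -> p <= 2 ->
  `|y| <= (p - 1) * x -> 0 <= s -> x ^+ 2 + y ^+ 2 <= s ^+ 2 ->
  finitely_supported f1 -> finitely_supported f2 ->
  lp_mass G p (fun v => modulus
    (f1 v + (- (x * laplacian G f1 v) + y * laplacian G f2 v))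
    (f2 v + (- (x * laplacian G f2 v) - y * laplacian G f1 v))) <=
  (1 + 384 * M `^ p * s `^ p) * lp_mass G p (fun v => modulus (f1 v) (f2 v)).
Proof.
move=> hM M0 p1 p2 yx s0 xys ff1 ff2.
have p0 : 0 < p by lra.
have pN0 : p != 0 by rewrite gt_eqF.
pose A := [set v | f1 v != 0] `|` [set v | f2 v != 0].
have finA : finite_set A by rewrite finite_setU.
have f1A : supported f1 A.
  by move=> v Av; apply: (@supported_support _ _ f1) => fv; apply: Av; left.
have f2A : supported f2 A.
  by move=> v Av; apply: (@supported_support _ _ f2) => fv; apply: Av; right.
have [S AS] := nbhd_exists G finA.
have d1 := laplacian_notin AS f1A; have d2 := laplacian_notin AS f2A.
have z1 := supported_notin AS f1A; have z2 := supported_notin AS f2A.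
have mod00 : modulus 0 0 = 0 :> R by rewrite modulus_real normr0.
set D1 := laplacian G f1; set D2 := laplacian G f2.
rewrite (@lp_mass_fset _ _ _ _ _ S pN0); last first.
  move=> v vS; rewrite /D1 /D2 d1// d2// z1// z2//.
  by rewrite !(mulr0, oppr0, addr0, subr0).
rewrite (@lp_mass_fset _ _ _ _ (fun v => modulus (f1 v) (f2 v)) S pN0); last first.
  by move=> v vS; rewrite z1// z2.
have cmp (g1 g2 : V -> R) (c : R) : 0 <= c -> 
    c * \sum_(v <- S) nu G v * `|modulus (g1 v) (g2 v)| `^ p <=
    c * (4 * (\sum_(v <- S) nu G v * `|g1 v| `^ p + \sum_(v <- S) nu G v * `|g2 v| `^ p)).
  move=> c0; apply: ler_wpM2l => //.
  rewrite -big_split/= mulr_sumr; apply: ler_sum => v _.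
  rewrite -mulrDr mulrCA ler_wpM2l ?(ltW (nu_gt0 G v))//.
  have p02 : 0 <= p <= 2 by apply/andP; split; lra.
  apply: le_trans (powR_add_le p02 (normr_ge0 _) (normr_ge0 _)).
  by rewrite ge0_ler_powR ?nnegrE ?addr_ge0 ?(ltW p0)// ger0_norm ?modulus_ge0// modulus_le_add.
have diss := dissipation p1 p2 yx AS f1A f2A.
rewrite -/D1 -/D2 in diss.
set U := \sum_(v <- S) nu G v * `|modulus (f1 v) (f2 v)| `^ p.
have step : \sum_(v <- S) nu G v * `|modulus (f1 v + (- (x * D1 v) + y * D2 v))
    (f2 v + (- (x * D2 v) - y * D1 v))| `^ p <=
    U + 6 * s `^ p * \sum_(v <- S) nu G v * `|modulus (D1 v) (D2 v)| `^ p.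
  apply: (@le_trans _ _ (U + p * \sum_(v <- S) nu G v * (phi_weight p (f1 v) (f2 v) *
    (f1 v * (- (x * D1 v) + y * D2 v) + f2 v * (- (x * D2 v) - y * D1 v))) +
    6 * s `^ p * \sum_(v <- S) nu G v * `|modulus (D1 v) (D2 v)| `^ p)); last first.
    by rewrite lerD2r gerDl pmulr_rle0.
  rewrite /U !mulr_sumr -!big_split/=; apply: ler_sum => v _.
  rewrite !ger0_norm ?modulus_ge0//.
  have h := modulus_powR_add p1 p2 (f1 v) (f2 v) (- (x * D1 v) + y * D2 v)
    (- (x * D2 v) - y * D1 v).
  have h2 : modulus (- (x * D1 v) + y * D2 v) (- (x * D2 v) - y * D1 v) `^ p <=
     s `^ p * modulus (D1 v) (D2 v) `^ p.
    rewrite -powRM ?modulus_ge0// ge0_ler_powR ?nnegrE ?mulr_ge0 ?modulus_ge0 ?(ltW p0)//.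
    apply: modulus_le; first by rewrite mulr_ge0 ?modulus_ge0.
    rewrite exprMn modulus_sqr.
    rewrite [leLHS](_ : _ = (x ^+ 2 + y ^+ 2) * (D1 v ^+ 2 + D2 v ^+ 2)).
      by rewrite ler_wpM2r// addr_ge0 ?sqr_ge0.
    by move: (D1 v) (D2 v) => a b; ring.
  have h3 : modulus (f1 v + (- (x * D1 v) + y * D2 v)) (f2 v + (- (x * D2 v) - y * D1 v)) `^ p
    <= modulus (f1 v) (f2 v) `^ p + p * (phi_weight p (f1 v) (f2 v) *
    (f1 v * (- (x * D1 v) + y * D2 v) + f2 v * (- (x * D2 v) - y * D1 v))) +
    6 * (s `^ p * modulus (D1 v) (D2 v) `^ p).
    by apply: (le_trans h); rewrite lerD2l ler_wpM2l.
  apply: le_trans (ler_wpM2l (ltW (nu_gt0 G v)) h3) _.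
  by rewrite le_eqVlt; apply/orP; left; apply/eqP; ring.
apply: (le_trans step).
have sp0 : 0 <= 6 * s `^ p by rewrite mulr_ge0 ?powR_ge0.
have h1 := lp_mass_laplacian hM M0 p1 p2 ff1.
have h2 := lp_mass_laplacian hM M0 p1 p2 ff2.
rewrite !(lp_mass_fset _ pN0 d1) !(lp_mass_fset _ pN0 z1) in h1.
rewrite !(lp_mass_fset _ pN0 d2) !(lp_mass_fset _ pN0 z2) in h2.
have u1 : \sum_(v <- S) nu G v * `|f1 v| `^ p <= U.
  apply: ler_sum => v _; rewrite ler_wpM2l ?(ltW (nu_gt0 G v))//.
  rewrite ge0_ler_powR ?nnegrE ?(ltW p0)// [leRHS]ger0_norm ?modulus_ge0//.
  by have [] := norm_le_modulus (f1 v) (f2 v).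
have u2 : \sum_(v <- S) nu G v * `|f2 v| `^ p <= U.
  apply: ler_sum => v _; rewrite ler_wpM2l ?(ltW (nu_gt0 G v))//.
  rewrite ge0_ler_powR ?nnegrE ?(ltW p0)// [leRHS]ger0_norm ?modulus_ge0//.
  by have [] := norm_le_modulus (f1 v) (f2 v).
have Mp0 : 0 <= 8 * M `^ p by rewrite mulr_ge0 ?powR_ge0.
have k1 := le_trans h1 (ler_wpM2l Mp0 u1).
have k2 := le_trans h2 (ler_wpM2l Mp0 u2).
have k := ler_wpM2l sp0 (ler_wpM2l (ler0n R 4) (lerD k1 k2)).
have := le_trans (cmp D1 D2 _ sp0) k.
clear k; clearbody U.
move=> k; rewrite [leRHS]mulrDl mul1r lerD2l (le_trans k)// le_eqVlt.
by apply/orP; left; apply/eqP; ring.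
Qed.

End SectorStep.

(** * Euler iterates along a circle of complex times *)

(** Multiplied by 2 sin (m pi / N), which is nonzero, the sum telescopes over a
    whole number of periods. *)
Lemma sum_cos_roots_of_unity (R : realType) (m N : nat) : (0 < m < N)%N ->
  \sum_(j < N) cos (m%:R * (j%:R * (pi *+ 2 / N%:R))) = 0 :> R.
Proof.
move=> /andP[m0 mN]; have N0 : (0 < N)%N by exact: ltn_trans mN.
have NR0 : 0 < N%:R :> R by rewrite ltr0n.
(* a is half the common difference of the angles. *)
pose a : R := m%:R * pi / N%:R.
have sa : 0 < sin a.
  apply: sin_gt0_pi; rewrite divr_gt0 ?mulr_gt0 ?pi_gt0 ?ltr0n//=.
  by rewrite ltr_pdivrMr// mulrC ltr_pM2l ?pi_gt0// ltr_nat.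
pose u j : R := sin (a *+ 2 * j%:R - a).
apply: (@mulfI _ (sin a *+ 2)); first by rewrite gt_eqF// pmulrn_lgt0.
rewrite mulr0 mulr_sumr (eq_bigr (fun j : 'I_N => u j.+1 - u j)); last first.
  move=> j _; have E : m%:R * (j%:R * (pi *+ 2 / N%:R)) = a *+ 2 * j%:R :> R.
    by rewrite /a; ring.
  rewrite E /u.
  have -> : a *+ 2 * j.+1%:R - a = a *+ 2 * j%:R + a.
    by rewrite -natr1; ring.
  by rewrite sinD sinB mulr2n; ring.
rewrite -(big_mkord xpredT (fun j => u j.+1 - u j)) telescope_sumr// /u.
rewrite mulr0 sub0r.
have -> : a *+ 2 * N%:R - a = - a + (pi *+ 2) *+ m.
  have -> : a *+ 2 * N%:R = (pi *+ 2) *+ m.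
    by rewrite -[RHS]mulr_natr /a; field; rewrite gt_eqF.
  by rewrite addrC.
by rewrite (periodicn (@sinD2pi R)) subrr.
Qed.

Section RotatedEuler.
Variables (R : realType) (V : choiceType) (G : weighted_graph R V).
Implicit Types (f : V -> R).
Local Notation Delta := (laplacian G).

Lemma laplacian_linear_sum (I : Type) (r : seq I) (c : I -> R) (F : I -> V -> R) x :
  Delta (fun v => \sum_(i <- r) c i * F i v) x = \sum_(i <- r) c i * Delta (F i) x.
Proof.
have E f : Delta f x = (nu G x)^-1 *
    \sum_(y <- fset_set [set y | edges G [set x; y]]) mu G x y * (f x - f y).
  rewrite /laplacian; congr (_ * _); apply: fsum_fset => y.
  rewrite in_fset_set; last exact: locally_finite.
  move=> /negP yN.
  have [->|/mu_neq0_edge exy] := eqVneq (mu G x y) 0; first by rewrite mul0r.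
  by case: yN; apply/mem_set.
rewrite E; under [RHS]eq_bigr do rewrite E mulrCA mulr_sumr.
rewrite -mulr_sumr exchange_big/=; congr (_ * _); apply: eq_bigr => y _.
by rewrite -sumrB mulr_sumr; apply: eq_bigr => i _; ring.
Qed.

Lemma laplacian0 x : Delta (fun=> 0) x = 0.
Proof.
have := laplacian_linear_sum (Nil nat) (fun=> 0) (fun=> fun=> 0) x.
rewrite [in RHS]big_nil => h; rewrite -[RHS]h; congr (Delta _ x).
by apply/funext => v; rewrite big_nil.
Qed.

Lemma laplacian_comb (c : R) f g x :
  Delta (fun v => f v + c * g v) x = Delta f x + c * Delta g x.
Proof.
have := laplacian_linear_sum [:: true; false] (fun b => if b then 1 else c)
  (fun b => if b then f else g) x.
rewrite !big_cons !big_nil !addr0 mul1r => <-; congr (Delta _ x).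
by apply/funext => v; rewrite !big_cons big_nil addr0 mul1r.
Qed.

Definition euler_step (t : R) f : V -> R := fun v => f v - t * Delta f v.

Definition euler (t : R) n f : V -> R := iter n (euler_step t) f.

Lemma laplacian_euler_step t f x :
  Delta (euler_step t f) x = euler_step t (Delta f) x.
Proof.
rewrite /euler_step -mulNr -laplacian_comb; congr (Delta _ x).
by apply/funext => v; rewrite mulNr.
Qed.

(** The coefficient of w^k in the polynomial (1 - (t + r w) Delta)^n f. *)
Fixpoint rotation_coef (t r : R) f n (k : nat) : V -> R :=
  if n is n'.+1 then fun v =>
    rotation_coef t r f n' k v - t * Delta (rotation_coef t r f n' k) v -
    (if k is k'.+1 then r * Delta (rotation_coef t r f n' k') v else 0)
  else if k is 0%N then f else fun=> 0.

Lemma rotation_coefS t r f n k v : rotation_coef t r f n.+1 k.+1 v =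
  rotation_coef t r f n k.+1 v - t * Delta (rotation_coef t r f n k.+1) v -
  r * Delta (rotation_coef t r f n k) v.
Proof. by []. Qed.

Lemma rotation_coef0 t r f n : rotation_coef t r f n 0 = euler t n f.
Proof.
elim: n => //= n IH; apply/funext => v.
by rewrite subr0 IH.
Qed.

Lemma rotation_coef_gt t r f n k : (n < k)%N -> rotation_coef t r f n k = fun=> 0.
Proof.
elim: n k => [|n IH] [|k]//= nk; apply/funext => v.
by rewrite !IH// ?laplacian0 ?(mulr0, subr0)// ltnW.
Qed.

(** The derivative at w = 0 of the polynomial (1 - (t + r w) Delta)^n.+1 f. *)
Lemma rotation_coef1 t r f n v :
  rotation_coef t r f n.+1 1 v = - (n.+1%:R * r) * Delta (euler t n f) v.
Proof.
elim: n v => [|n IH] v; first by rewrite /= laplacian0; ring.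
rewrite rotation_coefS rotation_coef0 IH.
have -> : rotation_coef t r f n.+1 1 =
    fun w => 0 + - (n.+1%:R * r) * Delta (euler t n f) w.
  by apply/funext => w; rewrite IH add0r.
rewrite laplacian_comb laplacian0 add0r.
rewrite [euler t n.+1 f]/(euler_step t (euler t n f)) laplacian_euler_step /euler_step.
by rewrite -[n.+2%:R]natr1; ring.
Qed.

Lemma rotation_coef_support t r f n : finitely_supported f ->
  exists S : {fset V}, forall k v, v \notin S -> rotation_coef t r f n k v = 0.
Proof.
move=> ff; elim: n => [|n [S S0]].
  exists (fset_set [set v | f v != 0]) => -[|k] v//=.
  rewrite in_fset_set// => /negP vS; apply: contrapT => /eqP fv.
  by apply: vS; apply/mem_set.
have [T ST] := nbhd_exists G (finite_fset S).
have supp k : supported (rotation_coef t r f n k) [set` S].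
  by move=> v /negP; exact: S0.
exists T => k v vT /=.
rewrite (supported_notin ST (supp k) vT) (laplacian_notin ST (supp k) vT).
case: k => [|k]; first by rewrite mulr0 !subr0.
by rewrite (laplacian_notin ST (supp k) vT) !mulr0 !subr0.
Qed.

(** Real and imaginary parts of (1 - (t + r w) Delta)^n f at w = e^(i psi),
    computed from the coefficients of index below N, which are all of them when
    n < N. *)
Definition rotation_re (t r psi : R) f N n v : R :=
  \sum_(k < N) cos (k%:R * psi) * rotation_coef t r f n k v.

Definition rotation_im (t r psi : R) f N n v : R :=
  \sum_(k < N) sin (k%:R * psi) * rotation_coef t r f n k v.

(** The recursion for the coefficients, summed against c.  Multiplication by w
    shifts the index; nothing is lost at the top since the last coefficient
    vanishes for n < N. *)
Lemma rotation_shift (c : R -> R) t r psi f N n v : (n < N)%N ->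
  \sum_(k < N.+1) c (k%:R * psi) * rotation_coef t r f n.+1 k v =
  \sum_(k < N.+1) c (k%:R * psi) * rotation_coef t r f n k v -
  t * (\sum_(k < N.+1) c (k%:R * psi) * Delta (rotation_coef t r f n k) v) -
  r * (\sum_(k < N.+1) c (k%:R * psi + psi) * Delta (rotation_coef t r f n k) v).
Proof.
move=> nN.
pose shift k := if k is k'.+1 then r * Delta (rotation_coef t r f n k') v else 0.
have E k : rotation_coef t r f n.+1 k v =
    rotation_coef t r f n k v - t * Delta (rotation_coef t r f n k) v - shift k by [].
rewrite (eq_bigr (fun k : 'I_N.+1 => c (k%:R * psi) * rotation_coef t r f n k v +
  (- t) * (c (k%:R * psi) * Delta (rotation_coef t r f n k) v) +
  (- (c (k%:R * psi) * shift k)))); last by move=> k _; rewrite E; ring.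
rewrite !big_split/= -mulr_sumr mulNr; congr (_ + _).
rewrite sumrN; congr (- _).
rewrite big_ord_recl/= mulr0 add0r.
rewrite [in RHS]big_ord_recr/= rotation_coef_gt// laplacian0 mulr0 addr0.
rewrite mulr_sumr; apply: eq_bigr => k _.
by rewrite /bump leq0n add1n -natr1 mulrDl mul1r /=; ring.
Qed.

Lemma rotation_step t r psi f N n v : (n < N)%N ->
  let x := t + r * cos psi in let y := r * sin psi in
  let f1 := rotation_re t r psi f N.+1 n in let f2 := rotation_im t r psi f N.+1 n in
  rotation_re t r psi f N.+1 n.+1 v = f1 v + (- (x * Delta f1 v) + y * Delta f2 v) /\
  rotation_im t r psi f N.+1 n.+1 v = f2 v + (- (x * Delta f2 v) - y * Delta f1 v).
Proof.
move=> nN x y f1 f2.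
pose L (k : 'I_N.+1) := Delta (rotation_coef t r f n k) v.
have D1 : Delta f1 v = \sum_(k < N.+1) cos (k%:R * psi) * L k by exact: laplacian_linear_sum.
have D2 : Delta f2 v = \sum_(k < N.+1) sin (k%:R * psi) * L k by exact: laplacian_linear_sum.
rewrite /rotation_re /rotation_im !rotation_shift//.
have F1 : f1 v = \sum_(k < N.+1) cos (k%:R * psi) * rotation_coef t r f n k v by [].
have F2 : f2 v = \sum_(k < N.+1) sin (k%:R * psi) * rotation_coef t r f n k v by [].
rewrite -F1 -F2 -D1 -D2.
have -> : \sum_(k < N.+1) cos (k%:R * psi + psi) * Delta (rotation_coef t r f n k) v =
    cos psi * Delta f1 v - sin psi * Delta f2 v.
  rewrite D1 D2 !mulr_sumr -sumrB; apply: eq_bigr => k _.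
  by rewrite cosD /L; ring.
have -> : \sum_(k < N.+1) sin (k%:R * psi + psi) * Delta (rotation_coef t r f n k) v =
    cos psi * Delta f2 v + sin psi * Delta f1 v.
  rewrite D1 D2 !mulr_sumr -big_split/=; apply: eq_bigr => k _.
  by rewrite sinD /L; ring.
by rewrite /x /y; split; ring.
Qed.

(** Cauchy's formula for the coefficient of w.  For a polynomial of degree less
    than N, averaging over the N-th roots of unity is exact. *)
Lemma rotation_average t r f N n v : (1 < N)%N ->
  \sum_(j < N) (cos (j%:R * (pi *+ 2 / N%:R)) *
                  rotation_re t r (j%:R * (pi *+ 2 / N%:R)) f N n v +
                sin (j%:R * (pi *+ 2 / N%:R)) *
                  rotation_im t r (j%:R * (pi *+ 2 / N%:R)) f N n v) =
  N%:R * rotation_coef t r f n 1 v.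
Proof.
move=> N1; pose psi (j : 'I_N) : R := j%:R * (pi *+ 2 / N%:R).
have E (j : 'I_N) : cos (psi j) * rotation_re t r (psi j) f N n v +
    sin (psi j) * rotation_im t r (psi j) f N n v =
    \sum_(k < N) cos (k%:R * psi j - psi j) * rotation_coef t r f n k v.
  rewrite !mulr_sumr -big_split/=; apply: eq_bigr => k _.
  by rewrite cosB; ring.
rewrite (eq_bigr _ (fun j _ => E j)) exchange_big/=.
have F (k : 'I_N) : \sum_(j < N) cos (k%:R * psi j - psi j) * rotation_coef t r f n k v =
    if k == Ordinal N1 then N%:R * rotation_coef t r f n 1 v else 0.
  rewrite -mulr_suml; case: k => -[|[|k]] kN; rewrite -val_eqE/=.
  - under eq_bigr do rewrite mul0r sub0r cosN -[psi _]mul1r.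
    by rewrite (@sum_cos_roots_of_unity _ 1)// mul0r.
  - under eq_bigr do rewrite mul1r subrr cos0.
    by rewrite sumr_const card_ord.
  - have -> : \sum_(j < N) cos (k.+2%:R * psi j - psi j) =
        \sum_(j < N) cos (k.+1%:R * psi j).
      by apply: eq_bigr => j _; rewrite -[k.+2%:R]natr1 mulrDl mul1r addrK.
    by rewrite sum_cos_roots_of_unity ?mul0r// (ltn_trans _ kN)/=.
by rewrite (eq_bigr _ (fun k _ => F k)) -big_mkcond big_pred1_eq.
Qed.

End RotatedEuler.

(** * Uniform bounds for the Euler iterates *)

Section EulerBounds.
Variables (R : realType) (V : choiceType) (G : weighted_graph R V).
Implicit Types (f : V -> R).
Local Notation Delta := (laplacian G).

(** The factor lost in one Euler step of complex size at most 2 t. *)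
Definition growth (p M t : R) : R := 1 + 384 * M `^ p * (2 * t) `^ p.

Lemma growth_ge1 p M t : 1 <= growth p M t.
Proof.
rewrite lerDl.
exact: mulr_ge0 (mulr_ge0 (ler0n R 384) (powR_ge0 _ _)) (powR_ge0 _ _).
Qed.

Lemma eq_lp_mass p f g : (forall v, `|f v| = `|g v|) -> lp_mass G p f = lp_mass G p g.
Proof. by move=> fg; apply: eq_fsbigr => v _; rewrite fg. Qed.

Lemma finitely_supported_euler t n f :
  finitely_supported f -> finitely_supported (euler G t n f).
Proof.
move=> ff; have [S S0] := rotation_coef_support G t 0 n ff.
rewrite -(rotation_coef0 G t 0 f n).
apply: (@finitely_supportedP _ _ _ [set` S]); first exact: finite_fset.
by move=> v /negP; exact: S0.
Qed.

Lemma finitely_supported_rotation (c : R -> R) t r psi f N n : finitely_supported f ->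
  finitely_supported (fun v => \sum_(k < N) c (k%:R * psi) * rotation_coef G t r f n k v).
Proof.
move=> ff; have [S S0] := rotation_coef_support G t r n ff.
apply: (@finitely_supportedP _ _ _ [set` S]); first exact: finite_fset.
by move=> v /negP vS; apply: big1 => k _; rewrite S0// mulr0.
Qed.

(** The hypothesis r <= (p - 1) (t - r) ensures that the disc of centre t and
    radius r lies in the sector of [sector_step]. *)
Lemma lp_mass_rotation (p M t r psi : R) f N n :
  (forall v, deg G v <= M * nu G v) -> 0 <= M -> 1 < p -> p <= 2 ->
  0 <= r -> r <= (p - 1) * (t - r) -> finitely_supported f -> (n <= N)%N ->
  lp_mass G p (fun v => modulus (rotation_re G t r psi f N.+1 n v)
                                (rotation_im G t r psi f N.+1 n v)) <=
  growth p M t ^+ n * lp_mass G p f.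
Proof.
move=> hM M0 p1 p2 r0 rt ff; elim: n => [_|n IH nN].
  rewrite expr0 mul1r (@eq_lp_mass _ _ f)// => v.
  rewrite /rotation_re /rotation_im !big_ord_recl/= !mul0r cos0 sin0 mul1r mul0r.
  by rewrite !big1 ?addr0 ?modulus_real ?normr_id// => k _; rewrite mulr0.
have tr0 : 0 <= t - r.
  by rewrite -(pmulr_rge0 _ (_ : 0 < p - 1)) ?subr_gt0// (le_trans r0).
have t0 : 0 <= t by lra.
set f1 := rotation_re G t r psi f N.+1 n; set f2 := rotation_im G t r psi f N.+1 n.
have ff1 : finitely_supported f1 by exact: finitely_supported_rotation.
have ff2 : finitely_supported f2 by exact: finitely_supported_rotation.
have := sin_max psi; have := cos_max psi; rewrite !ler_norml => /andP[c1 c2] /andP[s1 s2].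
have yx : `|r * sin psi| <= (p - 1) * (t + r * cos psi).
  apply: (@le_trans _ _ r).
    by rewrite normrM ger0_norm// ler_piMr// sin_max.
  apply: (le_trans rt); rewrite ler_wpM2l ?subr_ge0 ?(ltW p1)//.
  by have := ler_wpM2l r0 c1; lra.
have xy2 : (t + r * cos psi) ^+ 2 + (r * sin psi) ^+ 2 <= (2 * t) ^+ 2.
  have -> : (t + r * cos psi) ^+ 2 + (r * sin psi) ^+ 2 =
      t ^+ 2 + 2 * t * (r * cos psi) + r ^+ 2 * (cos psi ^+ 2 + sin psi ^+ 2) by ring.
  rewrite cos2Dsin2 mulr1.
  have h1 : r * cos psi <= t by apply: le_trans (ler_wpM2l r0 c2) _; lra.
  have h2 := ler_wpM2l t0 h1.
  have h3 : r ^+ 2 <= t ^+ 2 by rewrite ler_sqr ?nnegrE//; lra.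
  lra.
have t20 : 0 <= 2 * t by rewrite mulr_ge0.
have := sector_step hM M0 p1 p2 yx t20 xy2 ff1 ff2.
rewrite -/(growth p M t) => h.
rewrite (_ : (fun v => _) = (fun v => modulus
    (f1 v + (- ((t + r * cos psi) * Delta f1 v) + r * sin psi * Delta f2 v))
    (f2 v + (- ((t + r * cos psi) * Delta f2 v) - r * sin psi * Delta f1 v)))); last first.
  by apply/funext => v; have [-> ->] := rotation_step G t r psi f v nN.
apply: (le_trans h); rewrite exprS -mulrA ler_wpM2l//; last exact/IH/ltnW.
by rewrite (le_trans ler01)// growth_ge1.
Qed.

Lemma lp_mass_euler (p M t : R) f n :
  (forall v, deg G v <= M * nu G v) -> 0 <= M -> 1 < p -> p <= 2 ->
  0 <= t -> finitely_supported f ->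
  lp_mass G p (euler G t n f) <= growth p M t ^+ n * lp_mass G p f.
Proof.
move=> hM M0 p1 p2 t0 ff; elim: n => [|n IH]; first by rewrite expr0 mul1r.
have ff1 := finitely_supported_euler t n ff.
set g := euler G t n f in IH ff1.
have ff2 : finitely_supported (fun _ : V => 0 : R).
  apply: (@finitely_supportedP _ _ _ set0) => //.
have yx : `|0 : R| <= (p - 1) * t by rewrite normr0 mulr_ge0// subr_ge0 ltW.
have xy2 : t ^+ 2 + 0 ^+ 2 <= (2 * t) ^+ 2.
  rewrite expr0n/= addr0 exprMn; have := sqr_ge0 t; lra.
have t20 : 0 <= 2 * t by rewrite mulr_ge0.
have h := sector_step hM M0 p1 p2 yx t20 xy2 ff1 ff2.
rewrite -/(growth p M t) in h.
rewrite (@eq_lp_mass p (euler G t n.+1 f) (fun v => modulus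
    (g v + (- (t * Delta g v) + 0 * Delta (fun=> 0) v))
    (0 + (- (t * Delta (fun=> 0) v) - 0 * Delta g v)))); last first.
  move=> v; rewrite laplacian0 !(mul0r, mulr0, addr0, subr0, oppr0, add0r).
  by rewrite modulus_real normr_id.
rewrite (@eq_lp_mass p (fun v => modulus (g v) 0) g) in h; last first.
  by move=> v; rewrite modulus_real normr_id.
apply: (le_trans h); rewrite exprS -mulrA ler_wpM2l//.
by rewrite (le_trans ler01)// growth_ge1.
Qed.

Lemma norm_rotate_le (psi a b : R) : `|cos psi * a + sin psi * b| <= modulus a b.
Proof.
have m1 : modulus (cos psi) (sin psi) = 1 by rewrite /modulus cos2Dsin2 sqrtr1.
rewrite ler_norml lerNl.
have := dot_le_modulus (cos psi) (sin psi) a b; rewrite m1 mul1r => ->.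
have := dot_le_modulus (cos psi) (sin psi) (- a) (- b); rewrite m1 mul1r.
by rewrite /modulus !sqrrN !mulrN -opprD => ->.
Qed.

(** Cauchy's estimate on the circle of centre t and radius r, which is
    analyticity of the semigroup in discrete form.  By convexity of s -> s^p the
    bound on the circle passes to the average. *)
Lemma lp_mass_laplacian_euler (p M t r : R) f n :
  (forall v, deg G v <= M * nu G v) -> 0 <= M -> 1 < p -> p <= 2 ->
  0 <= r -> r <= (p - 1) * (t - r) -> finitely_supported f ->
  (n.+1%:R * r) `^ p * lp_mass G p (Delta (euler G t n f)) <=
  growth p M t ^+ n.+1 * lp_mass G p f.
Proof.
move=> hM M0 p1 p2 r0 rt ff.
have p0 : 0 < p by lra.
have pN0 : p != 0 by rewrite gt_eqF.
have [S S0] := rotation_coef_support G t r n.+1 ff.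
(* n.+2 roots of unity suffice, as the polynomial has degree n.+1. *)
pose N := n.+2; pose psi (j : 'I_N) : R := j%:R * (pi *+ 2 / N%:R).
pose m (j : 'I_N) v := modulus (rotation_re G t r (psi j) f N n.+1 v)
                               (rotation_im G t r (psi j) f N n.+1 v).
have N0 : 0 < N%:R :> R by rewrite ltr0n.
have Ni0 : 0 <= N%:R^-1 :> R by rewrite invr_ge0 ltW.
have sumN : \sum_(j < N) N%:R^-1 = 1 :> R.
  by rewrite sumr_const card_ord -[LHS]mulr_natr mulVf// gt_eqF.
have m0 j v : v \notin S -> m j v = 0.
  move=> vS; rewrite /m /rotation_re /rotation_im !big1 ?modulus_real ?normr0//.
    by move=> k _; rewrite S0// mulr0.
  by move=> k _; rewrite S0// mulr0.
have pt v : `|rotation_coef G t r f n.+1 1 v| `^ p <=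
    \sum_(j < N) N%:R^-1 * `|m j v| `^ p.
  have h : `|rotation_coef G t r f n.+1 1 v| <= \sum_(j < N) N%:R^-1 * m j v.
    rewrite -mulr_sumr mulrC ler_pdivlMr// mulrC.
    rewrite -[X in X * _]ger0_norm ?(ltW N0)// -normrM -rotation_average//.
    apply: le_trans (ler_norm_sum _ _ _) _; apply: ler_sum => j _.
    exact: norm_rotate_le.
  apply: (@le_trans _ _ ((\sum_(j < N) N%:R^-1 * m j v) `^ p)).
    rewrite ge0_ler_powR ?nnegrE ?(ltW p0)//; apply: sumr_ge0 => j _.
    by rewrite mulr_ge0// modulus_ge0.
  apply: le_trans (power_mean_sum _ (ltW p1) (fun=> Ni0) (fun j => modulus_ge0 _ _)) _.
  rewrite sumN powR1 mul1r; apply: ler_sum => j _.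
  by rewrite ger0_norm// modulus_ge0.
have -> : (n.+1%:R * r) `^ p * lp_mass G p (Delta (euler G t n f)) =
    lp_mass G p (rotation_coef G t r f n.+1 1).
  rewrite /lp_mass mulr_fsumr.
  apply: eq_fsbigr => v _; rewrite rotation_coef1 mulNr normrN.
  have nr0 : 0 <= n.+1%:R * r by rewrite mulr_ge0.
  by rewrite (normrM (n.+1%:R * r)) (ger0_norm nr0) (powRM _ nr0 (normr_ge0 _)) mulrCA.
rewrite (lp_mass_fset G pN0 (S0 1%N)).
apply: (@le_trans _ _ (\sum_(j < N) N%:R^-1 * lp_mass G p (m j))).
  under [leRHS]eq_bigr do rewrite (lp_mass_fset G pN0 (m0 _)) mulr_sumr.
  rewrite exchange_big/=; apply: ler_sum => v _.
  under [leRHS]eq_bigr do rewrite mulrCA.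
  by rewrite -mulr_sumr; apply: ler_wpM2l; [exact: ltW (nu_gt0 G v)|exact: pt].
apply: (@le_trans _ _ (\sum_(j < N) N%:R^-1 * (growth p M t ^+ n.+1 * lp_mass G p f))).
  by apply: ler_sum => j _; rewrite ler_wpM2l// lp_mass_rotation.
by rewrite -mulr_suml sumN mul1r.
Qed.

End EulerBounds.

(** * Convergence of the Euler iterates to the heat semigroup *)

Section HeatLimit.
Variables (R : realType) (V : choiceType) (G : weighted_graph R V).
Implicit Types (f : V -> R).
Local Notation Delta := (laplacian G).

Lemma euler_binomial (t : R) n f v : euler G t n f v =
  \sum_(k < n.+1) ('C(n, k)%:R * (- t) ^+ k) * iter k Delta f v.
Proof.
elim: n v => [|n IH] v; first by rewrite big_ord1 bin0 expr0 !mul1r.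
rewrite [LHS]/(euler_step G t (euler G t n f) v) /euler_step.
have -> : euler G t n f = fun w => \sum_(k < n.+1) ('C(n, k)%:R * (- t) ^+ k) * iter k Delta f w.
  exact/funext.
rewrite laplacian_linear_sum.
pose D k := iter k Delta f v.
have pascal (k : 'I_n.+1) : ('C(n.+1, k.+1)%:R * (- t) ^+ k.+1) * D k.+1 =
    ('C(n, k.+1)%:R * (- t) ^+ k.+1) * D k.+1 -
    t * (('C(n, k)%:R * (- t) ^+ k) * D k.+1) by rewrite binS natrD exprS; ring.
have head : \sum_(k < n.+1) ('C(n, k)%:R * (- t) ^+ k) * D k =
    D 0%N + \sum_(k < n.+1) ('C(n, k.+1)%:R * (- t) ^+ k.+1) * D k.+1.
  rewrite [in RHS]big_ord_recr/= bin_small// !mul0r addr0 big_ord_recl/= bin0 expr0 !mul1r.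
  by congr (_ + _); apply: eq_bigr => k _.
rewrite -/D head [RHS]big_ord_recl bin0 expr0 !mul1r -addrA; congr (_ + _).
rewrite mulr_sumr -sumrB; apply: eq_bigr => k _.
by rewrite lift0 -pascal.
Qed.

(** How far the binomial coefficient 'C(n, k) divided by (n + 1)^k is from
    1 / k!. *)
Lemma ffact_ratio_bounds (n k : nat) : (k <= n)%N ->
  let ratio : R := (n ^_ k)%:R / n.+1%:R ^+ k in
  0 <= ratio <= 1 /\ 1 - ratio <= k%:R ^+ 2 / n.+1%:R.
Proof.
have n0 : 0 < n.+1%:R :> R by rewrite ltr0n.
rewrite /=; elim: k => [|k IH] kn.
  by rewrite ffactn0 expr0 divr1 subrr expr0n/= mul0r ler01 lexx.
have [/andP[r0 r1] r2] := IH (ltnW kn).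
set x := (n ^_ k)%:R / n.+1%:R ^+ k in r0 r1 r2.
have -> : (n ^_ k.+1)%:R / n.+1%:R ^+ k.+1 = x - x * (k.+1%:R / n.+1%:R) :> R.
  rewrite ffactnSr natrM natrB 1?ltnW// exprSr /x -(@natr1 R n) -(@natr1 R k).
  by field; rewrite (@natr1 R n) pnatr_eq0/= expf_neq0// pnatr_eq0.
have q0 : 0 <= k.+1%:R / n.+1%:R :> R by rewrite divr_ge0.
have q1 : k.+1%:R / n.+1%:R <= 1 :> R by rewrite ler_pdivrMr// mul1r ler_nat ltnW.
have xq0 := mulr_ge0 r0 q0.
have xqx : x * (k.+1%:R / n.+1%:R) <= x by rewrite ler_piMr.
have xqq : x * (k.+1%:R / n.+1%:R) <= k.+1%:R / n.+1%:R by rewrite ler_piMl.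
have sq : k%:R ^+ 2 / n.+1%:R + k.+1%:R / n.+1%:R <= k.+1%:R ^+ 2 / n.+1%:R :> R.
  rewrite -mulrDl ler_pM2r ?invr_gt0// -(@natr1 R k).
  by have : 0 <= k%:R :> R by []; lra.
move: (x * _) xq0 xqx xqq => y y0 yx yq; split.
  by rewrite subr_ge0 yx/= (le_trans _ r1)// gerDl oppr_le0.
by apply: le_trans sq; rewrite opprB addrCA addrC lerD.
Qed.

Lemma sqr_le_exp4 (k : nat) : k%:R ^+ 2 <= 4 ^+ k :> R.
Proof.
rewrite -natrX -(natrX _ 4) ler_nat (_ : 4 = 2 ^ 2)%N// -expnM mulnC expnM leq_sqr.
exact/ltnW/ltn_expl.
Qed.

Lemma exp_partial_sum_le (c : R) n : 0 <= c ->
  \sum_(k < n) c ^+ k / k`!%:R <= expR c.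
Proof.
move=> c0; have h : nondecreasing_seq (series (exp_coeff c)).
  by apply: nondecreasing_series => k _ _; exact: exp_coeff_ge0.
have := nondecreasing_cvgn_le h (@is_cvg_series_exp_coeff R c) n.
by rewrite /series/= big_mkord.
Qed.

Lemma finitely_supported_bounded f : finitely_supported f ->
  exists B, forall v, `|f v| <= B.
Proof.
move=> ff; exists (\sum_(y <- fset_set [set y | f y != 0]) `|f y|) => y.
have [->|fy] := eqVneq (f y) 0; first by rewrite normr0 sumr_ge0.
rewrite (bigD1_seq y) ?fset_uniq//= ?lerDl ?sumr_ge0//.
by rewrite in_fset_set//; exact: mem_set.
Qed.

(** Compare the binomial expansion with the exponential series term by term.
    The relative error k^2 / (n + 1) is absorbed by k^2 <= 4^k, at the price of a
    factor 4 in the exponential. *)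
Lemma euler_sub_series (M B t : R) f : (forall v, deg G v / nu G v <= M) ->
  0 <= M -> 0 <= t -> (forall v, `|f v| <= B) -> forall n v,
  `|euler G (t / n.+1%:R) n f v -
    \sum_(k < n.+1) (- t) ^+ k / k`!%:R * iter k Delta f v| <=
  B * expR (4 * (t * (2 * M))) * n.+1%:R^-1.
Proof.
move=> hM M0 t0 hB n v.
have B0 : 0 <= B := le_trans (normr_ge0 _) (hB v).
have n0 : 0 < n.+1%:R :> R by rewrite ltr0n.
have iterB k w : `|iter k Delta f w| <= (2 * M) ^+ k * B.
  elim: k w => [|k IH] w /=; first by rewrite expr0 mul1r.
  by rewrite exprS -mulrA; exact: laplacian_bound.
rewrite euler_binomial -sumrB.
apply: le_trans (ler_norm_sum _ _ _) _.
apply: (@le_trans _ _ (\sum_(k < n.+1) (B / n.+1%:R) *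
    ((4 * (t * (2 * M))) ^+ k / k`!%:R))); last first.
  rewrite -mulr_sumr mulrAC ler_wpM2r ?invr_ge0 ?(ltW n0)// ler_wpM2l//.
  by apply: exp_partial_sum_le; rewrite !mulr_ge0.
apply: ler_sum => -[k kn] _ /=.
have [/andP[r0 r1] r2] := ffact_ratio_bounds (kn : (k <= n)%N).
set x := (n ^_ k)%:R / n.+1%:R ^+ k in r0 r1 r2.
have f0 : 0 < k`!%:R :> R by rewrite ltr0n fact_gt0.
have -> : 'C(n, k)%:R * (- (t / n.+1%:R)) ^+ k * iter k Delta f v -
    (- t) ^+ k / k`!%:R * iter k Delta f v =
    - ((- t) ^+ k / k`!%:R * (1 - x) * iter k Delta f v).
  rewrite -mulNr exprMn exprVn /x -bin_ffact natrM.
  by field; rewrite !gt_eqF ?exprn_gt0.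
rewrite normrN !normrM normrX normrN (ger0_norm t0).
rewrite (ger0_norm (_ : 0 <= k`!%:R^-1)) ?invr_ge0 ?(ltW f0)//.
rewrite ger0_norm ?subr_ge0//.
have e0 : 0 <= t ^+ k / k`!%:R by rewrite divr_ge0 ?exprn_ge0.
apply: (@le_trans _ _ (t ^+ k / k`!%:R * (4 ^+ k / n.+1%:R) * ((2 * M) ^+ k * B))).
  apply: ler_pM => //; first by rewrite mulr_ge0 ?subr_ge0.
  rewrite ler_wpM2l// (le_trans r2)// ler_wpM2r ?invr_ge0 ?(ltW n0)//.
  exact: sqr_le_exp4.
rewrite le_eqVlt; apply/orP; left; apply/eqP.
by rewrite !exprMn; field; rewrite !gt_eqF.
Qed.

Lemma euler_cvg_heat (M t : R) f : (forall v, deg G v / nu G v <= M) ->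
  0 <= M -> 0 <= t -> finitely_supported f -> forall v,
  (fun n => euler G (t / n.+1%:R) n f v) @ \oo --> heat G t f v.
Proof.
move=> hM M0 t0 ff v; have [B hB] := finitely_supported_bounded ff.
pose s n := series (fun k : nat => (- t) ^+ k / k`!%:R * iter k Delta f v) n.
have sl : (fun n => s n.+1) @ \oo --> heat G t f v.
  by rewrite (cvg_shiftS s); exact: heat_cvg hM ff v.
have d0 : (fun n => euler G (t / n.+1%:R) n f v - s n.+1) @ \oo --> 0.
  apply/norm_cvg0P.
  apply: (@squeeze_cvgr _ _ _ _ (fun=> 0)
    (fun n => B * expR (4 * (t * (2 * M))) * harmonic n)) => //.
  - near=> n; rewrite normr_ge0/= /s /series/= big_mkord.
    exact: euler_sub_series.
  - exact: cvg_cst.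
  - rewrite -[X in _ --> X](mulr0 (B * expR (4 * (t * (2 * M))))).
    by apply: cvgMr; exact: cvg_harmonic.
rewrite -[X in _ --> X]add0r.
have -> : (fun n => euler G (t / n.+1%:R) n f v) =
    (fun n => euler G (t / n.+1%:R) n f v - s n.+1) \+ (fun n => s n.+1).
  by apply/funext => n; rewrite /= subrK.
exact: cvgD.
Unshelve. all: by end_near. Qed.

End HeatLimit.

(** * Passage to the limit *)

(** Replacing s^p by its tangent at the limit makes the bound affine in a n, so
    that it passes to the limit by linearity. *)
Lemma finite_sum_powR_fatou (R : realType) (I : Type) (r : seq I) (w : I -> R)
    (a : nat -> I -> R) (l : I -> R) (p B : R) :
  1 <= p -> (forall i, 0 <= w i) -> (forall n i, 0 <= a n i) ->
  (forall i, 0 <= l i) -> (forall i, (fun n => a n i) @ \oo --> l i) ->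
  (\forall n \near \oo, \sum_(i <- r) w i * a n i `^ p <= B) ->
  \sum_(i <- r) w i * l i `^ p <= B.
Proof.
move=> p1 w0 a0 l0 al aB; have p0 : 0 < p by lra.
pose u n := \sum_(i <- r) w i * (p * (l i `^ (p - 1) * a n i)).
have ucvg : u @ \oo --> \sum_(i <- r) w i * (p * (l i `^ (p - 1) * l i)).
  apply: (@cvg_big R I +%R 0 xpredT (@add_continuous _) nat \oo r
    (fun i n => w i * (p * (l i `^ (p - 1) * a n i)))) => i _.
  by do 3 (apply: cvgMr).
have uB : \forall n \near \oo, u n <= (p - 1) * (\sum_(i <- r) w i * l i `^ p) + B.
  near=> n; apply: (@le_trans _ _ ((p - 1) * (\sum_(i <- r) w i * l i `^ p) +
      \sum_(i <- r) w i * a n i `^ p)); last by rewrite lerD2l; near: n.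
  rewrite mulr_sumr -big_split/=; apply: ler_sum => i _.
  have := ler_wpM2l (w0 i) (powR_tangent p1 (a0 n i) (l0 i)).
  by rewrite mulrDr [w i * ((p - 1) * _)]mulrCA.
have {uB} := cvgr_to_le ucvg uB => /(_ _).
have -> : \sum_(i <- r) w i * (p * (l i `^ (p - 1) * l i)) =
    p * \sum_(i <- r) w i * l i `^ p.
  rewrite mulr_sumr; apply: eq_bigr => i _.
  by rewrite [_ * l i]mulrC mulr_powRB1// mulrCA.
by move: (\sum_(i <- r) _) => S; lra.
Unshelve. all: by end_near. Qed.

Section LpNorms.
Variables (R : realType) (V : choiceType) (G : weighted_graph R V).
Implicit Types (f : V -> R).
Local Open Scope ereal_scope.

Lemma lp_norm_vertices (p : R) f : p != 0%R -> finitely_supported f ->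
  lp_norm [set: V] (nu G) p f = ((lp_mass G p f) `^ p^-1)%:E.
Proof.
move=> pN0 ff; rewrite /lp_norm -poweR_EFin; congr (_ `^ _).
rewrite (@lp_mass_fset _ _ _ _ _ (fset_set [set v | f v != 0%R]) pN0); last first.
  by move=> v; rewrite in_fset_set// => /negP vS; apply: contrapT => /eqP fv;
    apply: vS; apply/mem_set.
transitivity (\esum_(i in [set v | f v != 0%R]) (nu G i * `|f i| `^ p)%:E).
  rewrite [RHS]esum_mkcond; apply: eq_esum => v _; case: ifPn => // /negP vS.
  have -> : f v = 0%R.
    by apply: contrapT => /eqP fv; apply: vS; apply/mem_set.
  by rewrite normr0 powR0// mulr0.
rewrite esum_fset//; first by rewrite fsbig_finite// sumEFin.
by move=> v _; rewrite lee_fin mulr_ge0 ?powR_ge0// ltW ?nu_gt0.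
Qed.

Lemma lp_norm_edges_le (p B : R) (g : set V -> R) : (0 < p)%R ->
  (forall e, edges G e -> (0 <= g e)%R) ->
  (forall F : {fset set V}, {subset F <= edges G} ->
     (\sum_(e <- F) ew G e * g e `^ p <= B)%R) ->
  lp_norm (edges G) (ew G) p g <= (B `^ p^-1)%:E.
Proof.
move=> p0 g0 FB; rewrite /lp_norm -poweR_EFin.
have term_ge0 e : edges G e -> 0 <= (ew G e * `|g e| `^ p)%:E.
  by move=> Ge; rewrite lee_fin mulr_ge0 ?powR_ge0// ltW ?ew_gt0.
have B0 : (0 <= B)%R.
  by have := FB fset0; rewrite big_nil; apply=> e; rewrite inE.
apply: gt0_ler_poweR; rewrite ?invr_ge0 ?(ltW p0)//.
- by rewrite in_itv/= leey andbT esum_ge0.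
- by rewrite in_itv/= leey andbT lee_fin.
apply: ge_ereal_sup => _ [A [finA AE] <-].
rewrite fsbig_finite// sumEFin lee_fin.
have AF : {subset fset_set A <= edges G}.
  by move=> e; rewrite in_fset_set// => /set_mem /AE /mem_set.
apply: le_trans (FB _ AF); rewrite big_seq [leRHS]big_seq.
by apply: ler_sum => e /AF /set_mem Ge; rewrite ger0_norm ?g0.
Qed.

End LpNorms.

(** Each of the n + 1 steps costs at most 1 + 1 / (n + 1) once n is large,
    because the error of one step is of order (n + 1)^(-p) with p > 1. *)
Lemma growth_euler_le (R : realType) (p M t : R) : 1 < p -> 0 <= t ->
  \forall n \near \oo, growth p M (t / n.+1%:R) ^+ n.+1 <= expR 1.
Proof.
move=> p1 t0; pose K : R := 384 * M `^ p * (2 * t) `^ p.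
have K0 : 0 <= K := mulr_ge0 (mulr_ge0 (ler0n R 384) (powR_ge0 _ _)) (powR_ge0 _ _).
near=> n; have n0 : 0 < n.+1%:R :> R by rewrite ltr0n.
have Kn : K <= n.+1%:R `^ (p - 1).
  have -> : K = (K `^ (p - 1)^-1) `^ (p - 1).
    by rewrite -powRrM mulVf ?powRr1// subr_eq0 gt_eqF.
  rewrite ge0_ler_powR ?nnegrE ?powR_ge0 ?subr_ge0 ?(ltW p1) ?(ltW n0)//.
  rewrite -natr1 (@le_trans _ _ n%:R) ?lerDl//; apply: ltW.
  by near: n; exact: nbhs_infty_gtr.
have g1 : growth p M (t / n.+1%:R) <= 1 + n.+1%:R^-1.
  rewrite lerD2l mulrA powRM ?mulr_ge0 ?invr_ge0 ?(ltW n0)// mulrA -/K.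
  rewrite -[n.+1%:R^-1 in X in X <= _]powR_inv1 ?(ltW n0)// -powRrM mulN1r powRN.
  rewrite ler_pdivrMr ?powR_gt0// -(@mulr_powRB1 _ n.+1%:R p) ?(ltW n0)//; last by lra.
  by rewrite mulrA mulVf ?gt_eqF// mul1r.
apply: (@le_trans _ _ (expR n.+1%:R^-1 ^+ n.+1)).
  rewrite lerXn2r ?nnegrE ?expR_ge0//.
    by rewrite (le_trans ler01)// growth_ge1.
  by apply: le_trans g1 _; exact: expR_ge1Dx.
by rewrite -expRM_natl mulfV// gt_eqF.
Unshelve. all: by end_near. Qed.

Section MainEstimates.
Variables (R : realType) (V : choiceType) (G : weighted_graph R V).
Implicit Types (f : V -> R).

(** The gradient estimate for the Euler iterates, with the bounds of
    [lp_mass_euler] and [lp_mass_laplacian_euler], in the limit. *)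
Lemma heat_gradient_sum_le (p M t : R) f (F : {fset set V}) :
  (forall v, deg G v / nu G v <= M) -> 0 <= M -> 1 < p -> p <= 2 -> 0 < t ->
  finitely_supported f -> {subset F <= edges G} ->
  \sum_(e <- F) ew G e * absD (heat G t f) e `^ p <=
  gradient_const p M * (expR 1 * ((p - 1) / p * t) `^ (- (p / 2)) * lp_mass G p f).
Proof.
move=> hM M0 p1 p2 t0 ff FE.
have p0 : 0 < p by lra.
have hM' v : deg G v <= M * nu G v by rewrite -ler_pdivrMr ?nu_gt0.
(* kt is the radius r for which r = (p - 1) (t - r), the largest one allowed by
   the sector condition on the disc of centre t. *)
set kt := (p - 1) / p * t.
have kt0 : 0 < kt by rewrite mulr_gt0// divr_gt0// subr_gt0.
set m := lp_mass G p f; have m0 : 0 <= m := lp_mass_ge0 _ _ _.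
pose w n := euler G (t / n.+1%:R) n f.
(* The weights and the oscillations carry no sign condition outside the edges,
   so they are cut off by 0 there. *)
rewrite big_seq.
have -> : \sum_(e <- F | e \in F) ew G e * absD (heat G t f) e `^ p =
   \sum_(e <- F) (if e \in F then ew G e else 0) *
      (if e \in F then absD (heat G t f) e else 0) `^ p.
  by rewrite [RHS]big_seq; apply: eq_bigr => e ->.
apply: (@finite_sum_powR_fatou _ _ _ _ (fun n e => if e \in F then absD (w n) e else 0)).
- exact: ltW.
- by move=> e; case: ifPn => // /FE/set_mem/ew_gt0/ltW.
- by move=> n e; case: ifPn => // /FE/set_mem/edgesP[x [y ->]]; rewrite absDE.
- by move=> e; case: ifPn => // /FE/set_mem/edgesP[x [y ->]]; rewrite absDE.
- move=> e; case: ifPn => [/FE/set_mem/edgesP[x [y ->]]|_]; last exact: cvg_cst.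
  rewrite absDE; under eq_fun do rewrite absDE.
  apply: cvg_norm; apply: cvgB; apply: (euler_cvg_heat hM) => //; exact: ltW.
near=> n.
have n0 : 0 < n.+1%:R :> R by rewrite ltr0n.
have gn : growth p M (t / n.+1%:R) ^+ n.+1 <= expR 1.
  by near: n; apply: growth_euler_le => //; exact: ltW.
have tn0 : 0 <= t / n.+1%:R by rewrite divr_ge0// ltW.
have ffw : finitely_supported (w n) by exact: finitely_supported_euler.
have u_le : lp_mass G p (w n) <= expR 1 * m.
  apply: le_trans (lp_mass_euler n hM' M0 p1 p2 tn0 ff) _.
  by rewrite ler_wpM2r// (le_trans _ gn)// ler_weXn2l// growth_ge1.
have v_le : lp_mass G p (laplacian G (w n)) <= expR 1 * m * kt `^ (- p).
  rewrite powRN ler_pdivlMr ?powR_gt0// mulrC.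
  have r0 : 0 <= kt / n.+1%:R by rewrite divr_ge0// ltW.
  have rt : kt / n.+1%:R <= (p - 1) * (t / n.+1%:R - kt / n.+1%:R).
    rewrite le_eqVlt; apply/orP; left; apply/eqP.
    by rewrite /kt; field; rewrite !gt_eqF.
  have := lp_mass_laplacian_euler n hM' M0 p1 p2 r0 rt ff.
  rewrite mulrCA mulfV ?gt_eqF// mulr1 => h; apply: (le_trans h).
  by rewrite ler_wpM2r.
rewrite [leLHS](_ : _ = \sum_(e <- F) ew G e * absD (w n) e `^ p); last first.
  by rewrite big_seq [RHS]big_seq; apply: eq_bigr => e ->.
apply: le_trans (gradient_estimate hM' M0 p1 p2 ffw FE) _.
rewrite ler_wpM2l ?mulr_ge0 ?powR_ge0//.
have -> : expR 1 * kt `^ (- (p / 2)) * m = ((expR 1 * m) * (expR 1 * m * kt `^ (- p))) `^ 2^-1.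
  have em0 : 0 <= expR 1 * m by rewrite mulr_ge0 ?expR_ge0.
  rewrite mulrA powRM ?mulr_ge0 ?powR_ge0// -powRrM -expr2 -powR_mulrn// -powRrM.
  by rewrite mulfV// powRr1// mulNr mulrAC.
rewrite ge0_ler_powR ?nnegrE ?mulr_ge0 ?lp_mass_ge0 ?powR_ge0 ?expR_ge0//.
by rewrite ler_pM ?lp_mass_ge0.
Unshelve. all: by end_near. Qed.

End MainEstimates.

Theorem theorem1p1 (R : realType) (V : choiceType) (G : weighted_graph R V)
    (p : R)
    (hM : (ereal_sup (range (fun x : V => (deg G x / nu G x)%:E)) < +oo)%E)
    (hp : 1 < p <= 2) :
  exists2 C : R, 0 < C &
    forall f : V -> R, finitely_supported f -> forall t : R, 0 < t ->
      (lp_norm (edges G) (ew G) p (absD f) ^+ 2 <=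
         C%:E * lp_norm [set: V] (nu G) p f
              * lp_norm [set: V] (nu G) p (laplacian G f))%E /\
      (lp_norm (edges G) (ew G) p (absD (heat G t f)) <=
         (C * t `^ (- 2^-1))%:E * lp_norm [set: V] (nu G) p f)%E.
Proof.
have /andP[p1 p2] := hp; have p0 : 0 < p by lra.
have pN0 : p != 0 by rewrite gt_eqF.
have [M M0 degM] : exists2 M, 0 <= M & forall v, deg G v / nu G v <= M.
  set s := ereal_sup _ in hM.
  have sub v : ((deg G v / nu G v)%:E <= s)%E by apply: ereal_sup_ubound; exists v.
  exists `|fine s| => // v; apply: le_trans (ler_norm _).
  rewrite -lee_fin fineK// fin_numE -ltey hM andbT.
  by rewrite -ltNye (lt_le_trans _ (sub v))// ltNyr.
have degM' v : deg G v <= M * nu G v by rewrite -ler_pdivrMr ?nu_gt0.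
have absD_ge0 (f : V -> R) e : edges G e -> 0 <= absD f e.
  by move=> /edgesP[x [y ->]]; rewrite absDE.
pose c1 := gradient_const p M `^ p^-1 ^+ 2.
pose c2 := (gradient_const p M * (expR 1 * ((p - 1) / p) `^ (- (p / 2)))) `^ p^-1.
have gc0 : 0 <= gradient_const p M by rewrite mulr_ge0 ?powR_ge0.
have c10 : 0 <= c1 by rewrite exprn_ge0 ?powR_ge0.
have c20 : 0 <= c2 by rewrite powR_ge0.
exists (1 + c1 + c2); first by rewrite ltr_wpDr// ltr_pwDl.
move=> f ff t t0; have fD := finitely_supported_laplacian G ff.
rewrite !lp_norm_vertices//.
set u := lp_mass G p f; set v := lp_mass G p (laplacian G f).
have u0 : 0 <= u := lp_mass_ge0 _ _ _.
have v0 : 0 <= v := lp_mass_ge0 _ _ _.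
split.
  have h := lp_norm_edges_le p0 (absD_ge0 f) 
    (fun F FE => gradient_estimate degM' M0 p1 p2 ff FE).
  apply: le_trans (_ : ((gradient_const p M * (u * v) `^ 2^-1) `^ p^-1)%:E ^+ 2 <= _)%E.
    rewrite !expe2; apply: lee_pmul => //; exact: poweR_ge0.
  rewrite -EFin_expe -!EFinM lee_fin powRM ?powR_ge0// exprMn.
  rewrite [X in _ * X](_ : _ = u `^ p^-1 * v `^ p^-1); last first.
    rewrite -[LHS]powR_mulrn ?powR_ge0// -!powRrM powRM//.
    by rewrite (_ : 2^-1 * (p^-1 * 2%:R) = p^-1)//; field.
  rewrite -mulrA ler_wpM2r ?mulr_ge0 ?powR_ge0//.
  by rewrite -/c1 addrAC lerDr addr_ge0.
have h F FE := @heat_gradient_sum_le R V G p M t f F degM M0 p1 p2 t0 ff FE.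
apply: le_trans (lp_norm_edges_le p0 (absD_ge0 _) h) _.
rewrite -EFinM lee_fin -/u.
have kp0 : 0 <= (p - 1) / p by rewrite divr_ge0 ?subr_ge0 ?ltW.
set K := gradient_const p M * (expR 1 * ((p - 1) / p) `^ (- (p / 2))) in c2 c20 *.
have K0 : 0 <= K by rewrite mulr_ge0// mulr_ge0 ?expR_ge0 ?powR_ge0.
have -> : gradient_const p M * (expR 1 * ((p - 1) / p * t) `^ (- (p / 2)) * u) =
    K * (t `^ (- (p / 2)) * u).
  by rewrite (powRM _ kp0 (ltW t0)) /K; ring.
rewrite (powRM _ K0) ?mulr_ge0 ?powR_ge0// -/c2 (powRM _ (powR_ge0 _ _) u0) -powRrM.
rewrite (_ : - (p / 2) * p^-1 = - 2^-1); last by field.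
rewrite mulrA ler_wpM2r ?powR_ge0// ler_wpM2r ?powR_ge0//.
by rewrite lerDr addr_ge0.
Qed.
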